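(* Let $a\ge0$, $\gamma_1,\gamma_2\in\mathbb{N}_0$ and $f\in C^1_{\gamma_1,\gamma_2}(I)$. Then for every $(x,y)\in(0,\infty)\times(0,\infty)$, $$\lim_{n\to\infty}\Big(\frac{\partial}{\partial\omega}K_{n,n}^a(f;\omega,y)\Big)_{\omega=x}=\frac{\partial f}{\partial x}(x,y),\qquad \lim_{n\to\infty}\Big(\frac{\partial}{\partial\nu}K_{n,n}^a(f;x,\nu)\Big)_{\nu=y}=\frac{\partial f}{\partial y}(x,y).$$
   Context: $I=[0,\infty)\times[0,\infty)$, $\mathbb{N}=\{1,2,\dots\}$, $\mathbb{N}_0=\mathbb{N}\cup\{0\}$; $a\ge0$ is a fixed real parameter; functions are real-valued. Operators: let $(n)_0=1$, $(n)_i=n(n+1)\cdots(n+i-1)$ for $i\ge1$, $P_k(n,a)=\sum_{i=0}^{k}\binom{k}{i}(n)_i a^{k-i}$, and $$W_{n,k}^a(x)=e^{-\frac{ax}{1+x}}\frac{P_k(n,a)}{k!}\frac{x^k}{(1+x)^{n+k}},\qquad x\ge0,$$ (with $x^0=1$). Put $W^a_{n_1,n_2,k_1,k_2}(x,y)=W^a_{n_1,k_1}(x)W^a_{n_2,k_2}(y)$ and $$K_{n_1,n_2}^a(f;x,y)=(n_1+1)(n_2+1)\sum_{k_1=0}^\infty\sum_{k_2=0}^\infty W^a_{n_1,n_2,k_1,k_2}(x,y)\int_{\frac{k_2}{n_2+1}}^{\frac{k_2+1}{n_2+1}}\int_{\frac{k_1}{n_1+1}}^{\frac{k_1+1}{n_1+1}}f(u,v)\,du\,dv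 ;$$ $K_{n,n}^a$ is the case $n_1=n_2=n$. Weights and spaces: $\omega_\gamma(x)=(1+x^\gamma)^{-1}$ for $\gamma\in\mathbb{N}_0$ (with $x^0=1$), $\omega_{\gamma_1,\gamma_2}(x,y)=\omega_{\gamma_1}(x)\omega_{\gamma_2}(y)$. $C_{\gamma_1,\gamma_2}(I)$ is the set of $f\in C(I)$ such that $\omega_{\gamma_1,\gamma_2}f$ is bounded and uniformly continuous on $I$. For $m\in\mathbb{N}$, $C^m_{\gamma_1,\gamma_2}(I)$ is the space of $f\in C_{\gamma_1,\gamma_2}(I)$ whose partial derivatives $\frac{\partial^k f}{\partial x^s\partial y^{k-s}}$, $s=0,1,\dots,k$, $k=1,\dots,m$, belong to $C_{\gamma_1,\gamma_2}(I)$. *)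

(* Defs.v *)
From Stdlib Require Import Reals Factorial.
From Coquelicot Require Import Coquelicot.
Open Scope R_scope.

(** The closed quadrant is [0 <= x /\ 0 <= y]; a function on it is represented by
    a function [R -> R -> R] whose values outside the quadrant are irrelevant to
    every definition below. *)
Definition quadrant (p : R * R) : Prop := 0 <= fst p /\ 0 <= snd p.

Fixpoint rising (n i : nat) : R :=
  match i with
  | O => 1
  | S j => rising n j * INR (n + j)
  end.

(* [Binomial.C] is the binomial coefficient; plain [C] is the type of complex
   numbers here. *)
Definition P (k n : nat) (a : R) : R :=
  sum_n (fun i => Binomial.C k i * rising n i * a ^ (k - i)) k.

Definition W (a : R) (n k : nat) (x : R) : R :=
  exp (- (a * x / (1 + x))) * (P k n a / INR (fact k))
  * (x ^ k / (1 + x) ^ (n + k)).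

Definition W2 (a : R) (n1 n2 k1 k2 : nat) (x y : R) : R :=
  W a n1 k1 x * W a n2 k2 y.

Definition K (a : R) (n1 n2 : nat) (f : R -> R -> R) (x y : R) : R :=
  (INR n1 + 1) * (INR n2 + 1) *
  Series (fun k1 => Series (fun k2 =>
    W2 a n1 n2 k1 k2 x y *
    RInt (fun v =>
      RInt (fun u => f u v) (INR k1 / (INR n1 + 1)) ((INR k1 + 1) / (INR n1 + 1)))
      (INR k2 / (INR n2 + 1)) ((INR k2 + 1) / (INR n2 + 1)))).

Definition weight (g : nat) (x : R) : R := / (1 + x ^ g).

Definition weight2 (g1 g2 : nat) (x y : R) : R := weight g1 x * weight g2 y.

Definition bounded_on_quadrant (h : R -> R -> R) : Prop :=
  exists M : R, forall x y : R, 0 <= x -> 0 <= y -> Rabs (h x y) <= M.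

Definition unif_continuous_on_quadrant (h : R -> R -> R) : Prop :=
  forall eps : R, 0 < eps -> exists delta : R, 0 < delta /\
    forall x y x' y' : R, 0 <= x -> 0 <= y -> 0 <= x' -> 0 <= y' ->
      Rabs (x' - x) < delta -> Rabs (y' - y) < delta ->
      Rabs (h x' y' - h x y) < eps.

Definition C_weighted (g1 g2 : nat) (f : R -> R -> R) : Prop :=
  continuous_on quadrant (fun p : R * R => f (fst p) (snd p)) /\
  bounded_on_quadrant (fun x y => weight2 g1 g2 x y * f x y) /\
  unif_continuous_on_quadrant (fun x y => weight2 g1 g2 x y * f x y).

(** [g] is the partial derivative of [f] on the closed quadrant. The increments
    stay in the quadrant, so the derivative is one-sided on the boundary. *)
Definition is_partial_x (f g : R -> R -> R) : Prop :=
  forall x y : R, 0 <= x -> 0 <= y ->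
    filterlim (fun t => (f t y - f x y) / (t - x))
      (within (fun t => 0 <= t) (locally' x)) (locally (g x y)).

Definition is_partial_y (f g : R -> R -> R) : Prop :=
  forall x y : R, 0 <= x -> 0 <= y ->
    filterlim (fun t => (f x t - f x y) / (t - y))
      (within (fun t => 0 <= t) (locally' y)) (locally (g x y)).

(** [D s t] is the partial derivative of [f], [t] times in [y] and then [s] times
    in [x]. *)
Definition Cm_weighted (m g1 g2 : nat) (f : R -> R -> R) : Prop :=
  C_weighted g1 g2 f /\
  exists D : nat -> nat -> R -> R -> R,
    D O O = f /\
    (forall t : nat, (t < m)%nat -> is_partial_y (D O t) (D O (S t))) /\
    (forall s t : nat, (s + t < m)%nat -> is_partial_x (D s t) (D (S s) t)) /\
    (forall s t : nat, (1 <= s + t <= m)%nat -> C_weighted g1 g2 (D s t)).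

(* Main.v *)
Require Import Defs.
From Stdlib Require Import Reals Factorial Lra Lia.
From Coquelicot Require Import Coquelicot.
Open Scope R_scope.

(** With [t = x / (1 + x)], the functions [W a n k x] are the terms of the
    expansion of [e^(at) (1 - t)^(-n)] divided by its sum, hence the weights of a
    probability distribution on the indices [k], and [K a n n f x y] is the
    expectation, under two independent copies of it, of the average of [f] over
    the cell with index [(k1, k2)].

    The generating function [G_n = e^(at) (1 - t)^(-n)] satisfies
    [G_n' = a G_n + n G_(n+1)] and [G_n = (1 - t) G_(n+1)]. Differentiating the
    power series term by term, these relations give ([mean_is_derive])
      [d/dx E_n H = a / (1 + x)^2 E_n (Delta H) + n E_(n+1) (Delta H)]
    where [Delta] is the forward difference. Hence the derivative of the operator
    involves only differences of averages over adjacent cells, and by the mean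
    value theorem [n + 1] times such a difference is an average of values of the
    partial derivative [g] of [f] close to [(k1 / n, k2 / n)]. So the derivative
    of [K] is, up to factors tending to [0] and [1], an expectation of [g], and it
    remains to run a Korovkin argument for [g]: the increment of [g] from [(x, y)]
    is at most [e + c ((u - x)^2 + (v - y)^2) (1 + u^g1) (1 + v^g2)]
    ([weighted_close]), and the expectation of the second term tends to zero
    because the [m]-th moment of [k / n] tends to [x^m] for every [m]
    ([moment_limit]). The moments are computed recursively, since the differential
    equation for [G_n] turns multiplication by [k] into a shift ([mean_index]).

    The derivative in [y] is the same statement for the transposed array of cell
    averages, once the two sums have been interchanged ([mean2_swap]). *)

(** Summation and scaling lemmas stated over abstract structures leave equations
    whose type is a projection of such a structure; [ring] and [field] need the
    type to be [R] itself. *)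
Ltac eqR := match goal with |- @eq _ ?u ?v => change (@eq R u v) end.

Lemma ex_series_mult_l (c : R) (u : nat -> R) :
  ex_series u -> ex_series (fun k => c * u k).
Proof. exact (ex_series_scal_l c u). Qed.

Lemma ex_series_dominated (u v : nat -> R) :
  (forall k, Rabs (u k) <= v k) -> ex_series v -> ex_series u.
Proof. exact (ex_series_le (V := R_CompleteNormedModule) u v). Qed.

(** * The coefficients of the basis functions *)

Lemma rising_succ (n i : nat) : rising n (S i) = INR n * rising (S n) i.
Proof.
  induction i as [|i IH].
  - simpl; rewrite Nat.add_0_r; ring.
  - change (rising n (S i) * INR (n + S i)
            = INR n * (rising (S n) i * INR (S n + i))).
    rewrite IH; replace (n + S i)%nat with (S n + i)%nat by lia; ring.
Qed.

Lemma rising_nonneg (n i : nat) : 0 <= rising n i.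
Proof.
  induction i as [|i IH]; simpl; [lra|].
  apply Rmult_le_pos; [exact IH | apply pos_INR].
Qed.

Definition coef (a : R) (n k : nat) : R := P k n a / INR (fact k).

(** The coefficients are the Cauchy product of those of [exp (a t)] and of
    [(1 - t)^(-n)]. *)
Lemma coef_convolution (a : R) (n k : nat) :
  coef a n k = sum_n (fun i => rising n i / INR (fact i)
                             * (a ^ (k - i) / INR (fact (k - i)))) k.
Proof.
  unfold coef, P, Rdiv; rewrite Rmult_comm, <- (sum_n_mult_l (K := R_Ring)).
  apply sum_n_ext; intro i; eqR; unfold mult; simpl; unfold Binomial.C.
  field; repeat split; apply INR_fact_neq_0.
Qed.

Lemma sum_n_first (u : nat -> R) (k : nat) :
  sum_n u (S k) = u O + sum_n (fun i => u (S i)) k.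
Proof.
  unfold sum_n; rewrite sum_Sn_m by lia.
  now rewrite (sum_n_m_S u 0 k).
Qed.

Lemma coef_zero_order (a : R) (k : nat) : coef a 0 k = a ^ k / INR (fact k).
Proof.
  rewrite coef_convolution.
  destruct k as [|k].
  - rewrite sum_O; simpl; field.
  - rewrite sum_n_first, (sum_n_ext _ (fun _ => 0)).
    + rewrite sum_n_const; simpl (rising 0 0); rewrite Nat.sub_0_r.
      change (fact 0) with 1%nat.
      simpl (INR 1); field; apply INR_fact_neq_0.
    + intro i; eqR; rewrite rising_succ; simpl (INR 0); unfold Rdiv; ring.
Qed.

Lemma coef_first (a : R) (n : nat) : coef a n 0 = 1.
Proof. rewrite coef_convolution, sum_O; simpl; field. Qed.

Lemma coef_nonneg (a : R) (n k : nat) : 0 <= a -> 0 <= coef a n k.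
Proof.
  intro ha; rewrite coef_convolution.
  rewrite <- (Rmult_0_r (INR (S k))), <- sum_n_const.
  apply (sum_n_m_le (fun _ => 0)); intro i.
  pose proof (INR_fact_lt_0 i); pose proof (INR_fact_lt_0 (k - i)).
  apply Rmult_le_pos; apply Rdiv_le_0_compat; auto.
  - apply rising_nonneg.
  - now apply pow_le.
Qed.

(** For the generating function [e^(at) (1 - t)^(-n)] this says that raising [n] by
    one is division by [1 - t]. *)
Lemma coef_pascal (a : R) (n k : nat) :
  coef a (S n) (S k) = coef a n (S k) + coef a (S n) k.
Proof.
  rewrite !coef_convolution, !sum_n_first.
  change (rising n 0) with 1; change (rising (S n) 0) with 1.
  rewrite Rplus_assoc; f_equal.
  rewrite <- (sum_n_plus (G := R_AbelianMonoid)).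
  apply sum_n_ext; intro i; eqR; simpl (S k - S i)%nat; change plus with Rplus.
  rewrite <- Rmult_plus_distr_r; f_equal.
  rewrite (rising_succ n i).
  change (rising (S n) (S i)) with (rising (S n) i * INR (S n + i)).
  change (fact (S i)) with (S i * fact i)%nat.
  rewrite mult_INR, plus_INR, !S_INR.
  field; split; [apply INR_fact_neq_0 | rewrite <- S_INR; apply not_0_INR; lia].
Qed.

Lemma coef_partial_sums (a : R) (n k : nat) :
  coef a (S n) k = sum_n (coef a n) k.
Proof.
  induction k as [|k IH].
  - now rewrite sum_O, !coef_first.
  - rewrite sum_Sn, coef_pascal, <- IH; change plus with Rplus; ring.
Qed.

(** The coefficient form of [G_n' = a G_n + n G_(n+1)] for
    [G_n (t) = e^(at) (1 - t)^(-n)]. Pascal's rule carries it from [n] to [n + 1],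
    by an inner induction on [k]. *)
Lemma coef_ode (a : R) (n k : nat) :
  INR (S k) * coef a n (S k) = a * coef a n k + INR n * coef a (S n) k.
Proof.
  revert k; induction n as [|n IHn]; intro k.
  - rewrite !coef_zero_order.
    change (fact (S k)) with (S k * fact k)%nat; rewrite mult_INR.
    simpl (a ^ S k); simpl (INR 0).
    field; split; [apply INR_fact_neq_0 | apply not_0_INR; lia].
  - induction k as [|k IHk].
    + rewrite coef_pascal, !coef_first.
      specialize (IHn O); rewrite !coef_first in IHn.
      rewrite !S_INR in *; simpl (INR 0) in *; lra.
    + rewrite (coef_pascal a n (S k)), (coef_pascal a (S n) k).
      specialize (IHn (S k)).
      rewrite (coef_pascal a n k) in IHk |- *.
      rewrite (coef_pascal a n k) in IHn.
      rewrite !S_INR in *; nra.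
Qed.

(** By Pascal's rule the coefficients of order [n + 1] are the partial sums of
    those of order [n], so each step is a product with the geometric series. *)
Lemma coef_generating (a t : R) (n : nat) : 0 <= a -> 0 <= t < 1 ->
  is_series (fun k => coef a n k * t ^ k) (exp (a * t) / (1 - t) ^ n).
Proof.
  intros ha ht; induction n as [|n IH].
  - replace (exp (a * t) / (1 - t) ^ 0) with (exp (a * t)) by (simpl; field).
    generalize (is_exp_Reals (a * t)); apply is_series_ext; intro k.
    rewrite coef_zero_order, pow_n_pow, Rpow_mult_distr.
    unfold scal; simpl; unfold mult; simpl; unfold Rdiv; ring.
  - replace (exp (a * t) / (1 - t) ^ S n)
      with (exp (a * t) / (1 - t) ^ n * / (1 - t)).
    2:{ simpl; field; split; [apply pow_nonzero|]; lra. }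
    assert (hg : is_series (fun k => t ^ k) (/ (1 - t))).
    { apply is_series_geom; rewrite Rabs_pos_eq; lra. }
    generalize (is_series_mult_pos _ _ _ _ IH hg
      (fun k => Rmult_le_pos _ _ (coef_nonneg a n k ha) (pow_le t k (proj1 ht)))
      (fun k => pow_le t k (proj1 ht))).
    apply is_series_ext; intro k.
    rewrite <- sum_n_Reals, coef_partial_sums, Rmult_comm.
    rewrite <- (sum_n_mult_l (K := R_Ring)).
    unfold sum_n; apply sum_n_m_ext_loc; intros i hi; eqR.
    replace k with (i + (k - i))%nat at 2 by lia.
    rewrite pow_add; unfold mult; simpl; ring.
Qed.

(** * The basis functions as probability weights *)

(** In the variable [t = x / (1 + x)], which satisfies [1 - t = / (1 + x)], the
    basis function is a power-series term divided by the generating function. *)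
Lemma W_coef (a x : R) (n k : nat) : 0 <= x ->
  W a n k x = exp (- (a * x / (1 + x))) * / (1 + x) ^ n
              * (coef a n k * (x / (1 + x)) ^ k).
Proof.
  intro hx; unfold W; fold (coef a n k).
  unfold Rdiv; rewrite pow_add, Rpow_mult_distr, pow_inv.
  field; repeat split; apply pow_nonzero; lra.
Qed.

Lemma W_nonneg (a x : R) (n k : nat) : 0 <= a -> 0 <= x -> 0 <= W a n k x.
Proof.
  intros ha hx; unfold W; fold (coef a n k).
  apply Rmult_le_pos; [apply Rmult_le_pos|].
  - left; apply exp_pos.
  - now apply coef_nonneg.
  - apply Rdiv_le_0_compat; [now apply pow_le | apply pow_lt; lra].
Qed.

Lemma ratio_bounds (x : R) : 0 <= x -> 0 <= x / (1 + x) < 1.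
Proof.
  intro hx; split.
  - apply Rdiv_le_0_compat; lra.
  - apply (Rmult_lt_reg_r (1 + x)); [lra|]; field_simplify; lra.
Qed.

Lemma W_sum_one (a x : R) (n : nat) : 0 <= a -> 0 <= x ->
  is_series (fun k => W a n k x) 1.
Proof.
  intros ha hx.
  pose proof (coef_generating a _ n ha (ratio_bounds x hx)) as h.
  apply (is_series_scal_l (exp (- (a * x / (1 + x))) * / (1 + x) ^ n)) in h.
  replace 1 with (scal (exp (- (a * x / (1 + x))) * / (1 + x) ^ n)
    (exp (a * (x / (1 + x))) / (1 - x / (1 + x)) ^ n)).
  - revert h; apply is_series_ext; intro k; now rewrite W_coef.
  - unfold scal; simpl; unfold mult; simpl.
    replace (1 - x / (1 + x)) with (/ (1 + x)) by (field; lra).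
    replace (a * x / (1 + x)) with (a * (x / (1 + x))) by (field; lra).
    rewrite exp_Ropp, pow_inv.
    field; repeat split; try apply pow_nonzero; try lra.
    apply Rgt_not_eq, exp_pos.
Qed.

(** [coef_ode] in terms of the basis functions; it drives the computation of all
    moments. *)
Lemma W_index_weight (a x : R) (n k : nat) : 0 <= x ->
  INR (S k) * W a n (S k) x
  = a * (x / (1 + x)) * W a n k x + INR n * x * W a (S n) k x.
Proof.
  intro hx; rewrite !W_coef by exact hx.
  assert (h1 : 1 + x <> 0) by lra.
  transitivity (exp (- (a * x / (1 + x))) * / (1 + x) ^ n
     * (x / (1 + x)) ^ S k * (INR (S k) * coef a n (S k))); [ring|].
  rewrite coef_ode; simpl pow.
  field; split; auto; now apply pow_nonzero.
Qed.

Lemma W_order (a x : R) (n k : nat) : 0 <= x ->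
  W a n (S k) x = (1 + x) * W a (S n) (S k) x - x * W a (S n) k x.
Proof.
  intro hx; rewrite !W_coef by exact hx; rewrite coef_pascal.
  assert (h1 : 1 + x <> 0) by lra.
  simpl pow; field; split; auto; now apply pow_nonzero.
Qed.

(** * Expectations of sequences of polynomial growth *)

Definition mean (a x : R) (n : nat) (H : nat -> R) : R :=
  Series (fun k => W a n k x * H k).

Definition poly_growth (H : nat -> R) : Prop :=
  exists (M : R) (m : nat), forall k, Rabs (H k) <= M * (INR k + 1) ^ m.

(** Induction on the exponent: a factor [k] is absorbed by [W_index_weight], at
    the price of raising [n] and shifting the index, so both are generalized. *)
Lemma moment_summable (a x : R) (m n i : nat) : 0 <= a -> 0 <= x ->
  ex_series (fun k => W a n k x * (INR k + INR i) ^ m).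
Proof.
  intros ha hx; revert n i; induction m as [|m IH]; intros n i.
  - exists 1; generalize (W_sum_one a x n ha hx).
    apply is_series_ext; intro k; simpl; ring.
  - apply (ex_series_ext (fun k => INR k * W a n k x * (INR k + INR i) ^ m
                   + INR i * (W a n k x * (INR k + INR i) ^ m))).
    { intro k; eqR; simpl; ring. }
    apply (ex_series_plus (fun k => INR k * W a n k x * (INR k + INR i) ^ m)).
    + apply ex_series_incr_1.
      apply (ex_series_ext (fun k =>
        a * (x / (1 + x)) * (W a n k x * (INR k + INR (S i)) ^ m)
        + INR n * x * (W a (S n) k x * (INR k + INR (S i)) ^ m))).
      * intro k; eqR; rewrite (W_index_weight a x n k hx), !S_INR.
        replace (INR k + 1 + INR i) with (INR k + (INR i + 1)) by ring; ring.
      * apply (ex_series_plus (V := R_NormedModule)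
            (fun k => a * (x / (1 + x)) * (W a n k x * (INR k + INR (S i)) ^ m)));
          apply ex_series_mult_l; apply IH.
    + apply ex_series_mult_l; apply IH.
Qed.

Lemma poly_growth_nonneg_const (H : nat -> R) (M : R) (m : nat) :
  (forall k, Rabs (H k) <= M * (INR k + 1) ^ m) -> 0 <= M.
Proof.
  intro h; specialize (h O); simpl INR in h.
  rewrite Rplus_0_l, pow1, Rmult_1_r in h.
  pose proof (Rabs_pos (H O)); lra.
Qed.

Lemma mean_summable_abs (a x : R) (n : nat) (H : nat -> R) :
  0 <= a -> 0 <= x -> poly_growth H ->
  ex_series (fun k => Rabs (W a n k x * H k)).
Proof.
  intros ha hx [M [m h]].
  apply (ex_series_dominated _ (fun k => M * (W a n k x * (INR k + INR 1) ^ m))).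
  - intro k; rewrite Rabs_Rabsolu, Rabs_mult.
    rewrite (Rabs_pos_eq (W a n k x)) by now apply W_nonneg.
    specialize (h k); pose proof (W_nonneg a x n k ha hx).
    simpl (INR 1); nra.
  - apply ex_series_mult_l; now apply moment_summable.
Qed.

Lemma mean_summable (a x : R) (n : nat) (H : nat -> R) :
  0 <= a -> 0 <= x -> poly_growth H -> ex_series (fun k => W a n k x * H k).
Proof. intros ha hx h; apply ex_series_Rabs; now apply mean_summable_abs. Qed.

Lemma poly_growth_const (c : R) : poly_growth (fun _ => c).
Proof. exists (Rabs c), O; intro k; simpl; lra. Qed.

Lemma poly_growth_plus (H G : nat -> R) :
  poly_growth H -> poly_growth G -> poly_growth (fun k => H k + G k).
Proof.
  intros [M [m h]] [N [p g]]; exists (M + N), (m + p)%nat; intro k.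
  pose proof (poly_growth_nonneg_const _ _ _ h).
  pose proof (poly_growth_nonneg_const _ _ _ g).
  assert (hk : 1 <= INR k + 1) by (pose proof (pos_INR k); lra).
  pose proof (Rle_pow _ m (m + p)%nat hk ltac:(lia)).
  pose proof (Rle_pow _ p (m + p)%nat hk ltac:(lia)).
  eapply Rle_trans; [apply Rabs_triang|].
  specialize (h k); specialize (g k); nra.
Qed.

Lemma poly_growth_mult (H G : nat -> R) :
  poly_growth H -> poly_growth G -> poly_growth (fun k => H k * G k).
Proof.
  intros [M [m h]] [N [p g]]; exists (M * N), (m + p)%nat; intro k.
  rewrite Rabs_mult, pow_add.
  replace (M * N * ((INR k + 1) ^ m * (INR k + 1) ^ p))
    with ((M * (INR k + 1) ^ m) * (N * (INR k + 1) ^ p)) by ring.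
  apply Rmult_le_compat; auto using Rabs_pos.
Qed.

Lemma poly_growth_scal (c : R) (H : nat -> R) :
  poly_growth H -> poly_growth (fun k => c * H k).
Proof. intro h; apply poly_growth_mult; [apply poly_growth_const | exact h]. Qed.

Lemma poly_growth_index : poly_growth INR.
Proof.
  exists 1, 1%nat; intro k; pose proof (pos_INR k).
  rewrite Rabs_pos_eq; simpl; lra.
Qed.

Lemma poly_growth_pow (H : nat -> R) (m : nat) :
  poly_growth H -> poly_growth (fun k => H k ^ m).
Proof.
  intro h; induction m as [|m IH]; simpl.
  - apply poly_growth_const.
  - now apply poly_growth_mult.
Qed.

Lemma poly_growth_shift (H : nat -> R) :
  poly_growth H -> poly_growth (fun k => H (S k)).
Proof.
  intros [M [m h]]; exists (M * 2 ^ m), m; intro k.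
  pose proof (poly_growth_nonneg_const _ _ _ h).
  eapply Rle_trans; [apply h|].
  rewrite Rmult_assoc, <- Rpow_mult_distr.
  apply Rmult_le_compat_l; [assumption|].
  rewrite S_INR; pose proof (pos_INR k); apply pow_incr; lra.
Qed.

Lemma poly_growth_minus (H G : nat -> R) :
  poly_growth H -> poly_growth G -> poly_growth (fun k => H k - G k).
Proof.
  intros h g; destruct (poly_growth_plus _ _ h (poly_growth_scal (-1) _ g))
    as [M [m e]].
  exists M, m; intro k; specialize (e k).
  now replace (H k - G k) with (H k + -1 * G k) by ring.
Qed.

Lemma mean_ext (a x : R) (n : nat) (H G : nat -> R) :
  (forall k, H k = G k) -> mean a x n H = mean a x n G.
Proof. intro h; apply Series_ext; intro k; now rewrite h. Qed.

Lemma mean_scal (a x : R) (n : nat) (c : R) (H : nat -> R) :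
  mean a x n (fun k => c * H k) = c * mean a x n H.
Proof.
  unfold mean; rewrite <- Series_scal_l; apply Series_ext; intro k; ring.
Qed.

Lemma mean_const (a x : R) (n : nat) (c : R) : 0 <= a -> 0 <= x ->
  mean a x n (fun _ => c) = c.
Proof.
  intros ha hx; unfold mean; rewrite Series_scal_r.
  rewrite (is_series_unique _ _ (W_sum_one a x n ha hx)); ring.
Qed.

Lemma mean_plus (a x : R) (n : nat) (H G : nat -> R) : 0 <= a -> 0 <= x ->
  poly_growth H -> poly_growth G ->
  mean a x n (fun k => H k + G k) = mean a x n H + mean a x n G.
Proof.
  intros ha hx h g; unfold mean.
  rewrite <- Series_plus by now apply mean_summable.
  apply Series_ext; intro k; ring.
Qed.

Lemma mean_minus (a x : R) (n : nat) (H G : nat -> R) : 0 <= a -> 0 <= x ->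
  poly_growth H -> poly_growth G ->
  mean a x n (fun k => H k - G k) = mean a x n H - mean a x n G.
Proof.
  intros ha hx h g; unfold mean.
  rewrite <- Series_minus by now apply mean_summable.
  apply Series_ext; intro k; ring.
Qed.

Lemma mean_abs_le (a x : R) (n : nat) (H G : nat -> R) : 0 <= a -> 0 <= x ->
  poly_growth G ->
  (forall k, Rabs (H k) <= G k) -> Rabs (mean a x n H) <= mean a x n G.
Proof.
  intros ha hx g h; unfold mean.
  assert (hterm : forall k, 0 <= Rabs (W a n k x * H k) <= W a n k x * G k).
  { intro k; split; [apply Rabs_pos|].
    pose proof (W_nonneg a x n k ha hx).
    rewrite Rabs_mult, (Rabs_pos_eq (W a n k x)) by assumption.
    now apply Rmult_le_compat_l. }
  pose proof (mean_summable a x n G ha hx g) as hG.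
  eapply Rle_trans; [apply Series_Rabs | now apply Series_le].
  apply (ex_series_dominated _ (fun k => W a n k x * G k)); [|exact hG].
  intro k; rewrite Rabs_Rabsolu; apply hterm.
Qed.

(** A discrete integration by parts: multiplication by the index becomes a shift
    of the argument. *)
Lemma mean_index (a x : R) (n : nat) (H : nat -> R) : 0 <= a -> 0 <= x ->
  poly_growth H ->
  mean a x n (fun k => INR k * H k)
  = a * (x / (1 + x)) * mean a x n (fun k => H (S k))
    + INR n * x * mean a x (S n) (fun k => H (S k)).
Proof.
  intros ha hx h; unfold mean; pose proof (poly_growth_shift _ h).
  rewrite Series_incr_1.
  2:{ apply mean_summable; auto.
      apply poly_growth_mult; auto using poly_growth_index. }
  simpl (INR 0); rewrite <- !Series_scal_l, <- Series_plus.
  - rewrite Rmult_0_l, Rmult_0_r, Rplus_0_l; apply Series_ext; intro k.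
    transitivity (INR (S k) * W a n (S k) x * H (S k)); [ring|].
    rewrite W_index_weight by assumption; ring.
  - apply ex_series_mult_l; now apply mean_summable.
  - apply ex_series_mult_l; now apply mean_summable.
Qed.

(** Expresses an expectation of order [n] by expectations of order [n + 1], which
    is what turns the derivative below into an expectation of differences. *)
Lemma mean_order (a x : R) (n : nat) (H : nat -> R) : 0 <= a -> 0 <= x ->
  poly_growth H ->
  mean a x n H
  = (1 + x) * mean a x (S n) H - x * mean a x (S n) (fun k => H (S k)).
Proof.
  intros ha hx h; unfold mean; pose proof (poly_growth_shift _ h).
  rewrite Series_incr_1 by now apply mean_summable.
  rewrite (Series_incr_1 (fun k => W a (S n) k x * H k)) by now apply mean_summable.
  assert (h0 : W a n 0 x = (1 + x) * W a (S n) 0 x).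
  { rewrite !W_coef, !coef_first by assumption; simpl pow.
    field; split; [apply pow_nonzero|]; lra. }
  rewrite (Series_ext _ (fun k => (1 + x) * (W a (S n) (S k) x * H (S k))
                              - x * (W a (S n) k x * H (S k)))).
  2:{ intro k; rewrite (W_order a x n k hx); ring. }
  rewrite Series_minus, !Series_scal_l, h0; [ring| |];
    apply ex_series_mult_l.
  - now apply (ex_series_incr_1 (fun k => W a (S n) k x * H k)), mean_summable.
  - now apply mean_summable.
Qed.

(** * Differentiating an expectation *)

(** Every radius [r < 1] is the value of [X / (1 + X)] at some [X >= 0], so the
    terms at radius [r] are, up to a constant factor, those of a convergent
    expectation at [X]. *)
Lemma CV_radius_coef (a t : R) (n : nat) (H : nat -> R) :
  0 <= a -> 0 <= t < 1 -> poly_growth H ->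
  Rbar_lt (Rabs t) (CV_radius (fun k => coef a n k * H k)).
Proof.
  intros ha ht h; rewrite Rabs_pos_eq by apply ht.
  set (r := (1 + t) / 2); set (X := r / (1 - r)).
  assert (hr : 0 <= r < 1) by (unfold r; lra).
  assert (hX : 0 <= X) by (apply Rdiv_le_0_compat; lra).
  assert (hXr : X / (1 + X) = r) by (unfold X; field; lra).
  assert (hlim : is_lim_seq (fun k => coef a n k * H k * r ^ k) 0).
  { pose proof (mean_summable a X n H ha hX h) as hs.
    apply ex_series_lim_0 in hs.
    set (c := exp (- (a * X / (1 + X))) * / (1 + X) ^ n) in *.
    assert (hc : c <> 0).
    { apply Rmult_integral_contrapositive_currified.
      - apply Rgt_not_eq, exp_pos.
      - apply Rinv_neq_0_compat, pow_nonzero; lra. }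
    apply (is_lim_seq_scal_l _ (/ c)) in hs.
    replace (Rbar_mult (/ c) 0) with (Finite 0) in hs
      by (simpl; f_equal; ring).
    revert hs; apply is_lim_seq_ext; intro k.
    rewrite W_coef, hXr by exact hX; fold c; field; exact hc. }
  apply Rbar_not_le_lt; intro hle.
  refine (CV_disk_outside _ r _ hlim).
  rewrite Rabs_pos_eq by apply hr.
  eapply Rbar_le_lt_trans; [exact hle|]; simpl; unfold r; lra.
Qed.

Lemma mean_PSeries (a x : R) (n : nat) (H : nat -> R) : 0 <= x ->
  mean a x n H = exp (- (a * x / (1 + x))) * / (1 + x) ^ n
                 * PSeries (fun k => coef a n k * H k) (x / (1 + x)).
Proof.
  intro hx; unfold mean, PSeries; rewrite <- Series_scal_l.
  apply Series_ext; intro k; rewrite W_coef by exact hx; ring.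
Qed.

(** The [t]-derivative of the power series, rewritten by [coef_ode]. *)
Lemma mean_PSeries_derive (a x : R) (n : nat) (H : nat -> R) :
  0 <= a -> 0 <= x -> poly_growth H ->
  exp (- (a * x / (1 + x))) * / (1 + x) ^ n
    * PSeries (PS_derive (fun k => coef a n k * H k)) (x / (1 + x))
  = a * mean a x n (fun k => H (S k))
    + INR n * (1 + x) * mean a x (S n) (fun k => H (S k)).
Proof.
  intros ha hx h; pose proof (poly_growth_shift _ h).
  unfold mean, PSeries, PS_derive; rewrite <- !Series_scal_l, <- Series_plus;
    try (apply ex_series_mult_l; now apply mean_summable).
  apply Series_ext; intro k; rewrite !W_coef by exact hx.
  transitivity (exp (- (a * x / (1 + x))) * / (1 + x) ^ n
    * (INR (S k) * coef a n (S k)) * H (S k) * (x / (1 + x)) ^ k); [ring|].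
  rewrite coef_ode; simpl pow.
  field; split; [apply pow_nonzero|]; lra.
Qed.

(** The derivative of an expectation is a combination of expectations of the
    forward differences: the prefactor [e^(-at) (1 + x)^(-n)] contributes the
    unshifted terms, the power series the shifted ones, and [mean_order] matches
    their orders. *)
Lemma mean_is_derive (a x : R) (n : nat) (H : nat -> R) :
  0 <= a -> 0 < x -> poly_growth H ->
  is_derive (fun w => mean a w n H) x
    (a / (1 + x) ^ 2 * mean a x n (fun k => H (S k) - H k)
     + INR n * mean a x (S n) (fun k => H (S k) - H k)).
Proof.
  intros ha hx h; assert (hx0 : 0 <= x) by lra.
  pose proof (poly_growth_shift _ h) as h'.
  set (E := fun w => exp (- (a * w / (1 + w))) * / (1 + w) ^ n).
  set (S0 := PSeries (fun k => coef a n k * H k)).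
  apply (is_derive_ext_loc (fun w => E w * S0 (w / (1 + w)))).
  { exists (mkposreal x hx); intros w hw.
    assert (0 <= w).
    { change (Rabs (w - x) < x) in hw; apply Rabs_def2 in hw; lra. }
    symmetry; now apply mean_PSeries. }
  assert (dE : is_derive E x
    (E x * (- (a / (1 + x) ^ 2) - INR n / (1 + x)))).
  { unfold E; auto_derive.
    - repeat split; try lra; apply pow_nonzero; lra.
    (* The derivative of [(1 + w)^n] contains [n - 1], truncated at [0]. *)
    - unfold Rdiv, Rminus; destruct n as [|n].
      + simpl; field; lra.
      + simpl pred; simpl pow; rewrite Rmult_1_r.
        field; repeat split; try apply pow_nonzero; lra. }
  assert (dt : is_derive (fun w => w / (1 + w)) x (/ (1 + x) ^ 2)).
  { auto_derive; [lra|]; field; lra. }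
  assert (dS : is_derive (fun w => S0 (w / (1 + w))) x
    (/ (1 + x) ^ 2 * PSeries (PS_derive (fun k => coef a n k * H k))
                       (x / (1 + x)))).
  { apply (is_derive_comp S0); [|exact dt].
    apply is_derive_PSeries, CV_radius_coef; auto; now apply ratio_bounds. }
  evar_last; [apply (is_derive_mult (K := R_AbsRing) _ _ _ _ _ dE dS)|].
  { intros u v; apply Rmult_comm. }
  change (E x * (- (a / (1 + x) ^ 2) - INR n / (1 + x)) * S0 (x / (1 + x))
    + E x * (/ (1 + x) ^ 2 * PSeries (PS_derive (fun k => coef a n k * H k))
                       (x / (1 + x)))
    = a / (1 + x) ^ 2 * mean a x n (fun k => H (S k) - H k)
     + INR n * mean a x (S n) (fun k => H (S k) - H k)).
  pose proof (mean_PSeries a x n H hx0) as e0; fold S0 in e0.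
  pose proof (mean_PSeries_derive a x n H ha hx0 h) as e1.
  change (exp (- (a * x / (1 + x))) * / (1 + x) ^ n) with (E x) in e0, e1.
  transitivity ((- (a / (1 + x) ^ 2) - INR n / (1 + x)) * mean a x n H
    + / (1 + x) ^ 2 * (a * mean a x n (fun k => H (S k))
    + INR n * (1 + x) * mean a x (S n) (fun k => H (S k)))).
  { rewrite e0, <- e1; ring. }
  rewrite !mean_minus by assumption.
  rewrite (mean_order a x n H) at 1 by assumption.
  rewrite (mean_order a x n H) by assumption.
  field; lra.
Qed.

(** * Limits of moments *)

Lemma lim_inv_succ : is_lim_seq (fun n => / (INR n + 1)) 0.
Proof.
  replace (Finite 0) with (Rbar_inv p_infty) by reflexivity.
  apply is_lim_seq_inv; [|discriminate].
  generalize is_lim_seq_INR; intro h; apply is_lim_seq_incr_1 in h.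
  revert h; apply is_lim_seq_ext; intro n; apply S_INR.
Qed.

(** Splitting one factor as index plus [i], [mean_index] reduces the power
    [m + 1] to the power [m] with shifted parameters; only the term carrying the
    factor [n + j] survives division by [n + 1], and it contributes the factor
    [x]. *)
Lemma moment_limit (a x : R) (m i j : nat) : 0 <= a -> 0 <= x ->
  is_lim_seq (fun n => mean a x (n + j)
    (fun k => ((INR k + INR i) / (INR n + 1)) ^ m)) (x ^ m).
Proof.
  intros ha hx; revert i j; induction m as [|m IH]; intros i j.
  - apply (is_lim_seq_ext (fun _ => 1)); [|apply is_lim_seq_const].
    intro n; symmetry; now apply mean_const.
  - set (M := fun n i j => mean a x (n + j)
      (fun k => ((INR k + INR i) / (INR n + 1)) ^ m)).
    apply (is_lim_seq_ext (fun n =>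
      (a * (x / (1 + x)) * / (INR n + 1)) * M n (S i) j
      + ((1 + (INR j - 1) * / (INR n + 1)) * x) * M n (S i) (S j)
      + (INR i * / (INR n + 1)) * M n i j)).
    + intro n; unfold M.
      set (psi := fun k => ((INR k + INR i) / (INR n + 1)) ^ m).
      assert (hpsi : poly_growth psi).
      { apply poly_growth_pow; apply poly_growth_mult;
          [apply poly_growth_plus|]; auto using poly_growth_index, poly_growth_const. }
      rewrite (mean_ext a x (n + j)
        (fun k => ((INR k + INR i) / (INR n + 1)) ^ S m)
        (fun k => / (INR n + 1) * (INR k * psi k + INR i * psi k))).
      2:{ intro k; unfold psi; simpl; unfold Rdiv; ring. }
      rewrite mean_scal, mean_plus, mean_scal, mean_index; try assumption.
      2:{ apply poly_growth_mult; auto using poly_growth_index. }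
      2:{ now apply poly_growth_scal. }
      replace (n + S j)%nat with (S (n + j)) by lia.
      rewrite (mean_ext a x (n + j) (fun k => psi (S k))
        (fun k => ((INR k + INR (S i)) / (INR n + 1)) ^ m)).
      2:{ intro k; unfold psi; rewrite !S_INR; do 2 f_equal; ring. }
      rewrite (mean_ext a x (S (n + j)) (fun k => psi (S k))
        (fun k => ((INR k + INR (S i)) / (INR n + 1)) ^ m)).
      2:{ intro k; unfold psi; rewrite !S_INR; do 2 f_equal; ring. }
      rewrite plus_INR; pose proof (pos_INR n); field; lra.
    + pose proof lim_inv_succ as l0.
      assert (lc : forall c, is_lim_seq (fun n => c * / (INR n + 1)) 0).
      { intro c; replace (Finite 0) with (Rbar_mult c 0)
          by (simpl; f_equal; ring).
        now apply is_lim_seq_scal_l. }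
      replace (Finite (x ^ S m)) with
        (Finite (0 * x ^ m + ((1 + 0) * x) * x ^ m + 0 * x ^ m))
        by (simpl; f_equal; ring).
      apply is_lim_seq_plus'; [apply is_lim_seq_plus'|];
        apply is_lim_seq_mult'; try apply IH; try apply lc.
      apply is_lim_seq_mult'; [|apply is_lim_seq_const].
      apply is_lim_seq_plus'; [apply is_lim_seq_const | apply lc].
Qed.

(** The right end of the union of two consecutive cells: an increment of [f] from
    cell [k] to cell [k + 1] depends on the interval from [k / (n + 1)] to this
    point. *)
Definition node (n k : nat) : R := (INR k + 2) / (INR n + 1).
Definition growth (g n k : nat) : R := 1 + node n k ^ g.

(** A bound for [(xi - x)^2 (1 + xi^g)] over all [xi] in the two cells that end at
    [node n k]: the distance from [xi] to the node is at most [2 / (n + 1)]. *)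
Definition spread (x : R) (g n k : nat) : R :=
  (2 * (node n k - x) ^ 2 + 8 * / (INR n + 1) ^ 2) * growth g n k.

Lemma node_pos (n k : nat) : 0 < node n k.
Proof.
  pose proof (pos_INR n); pose proof (pos_INR k); apply Rdiv_lt_0_compat; lra.
Qed.

Lemma growth_ge_1 (g n k : nat) : 1 <= growth g n k.
Proof.
  unfold growth; pose proof (pow_le _ g (Rlt_le _ _ (node_pos n k))); lra.
Qed.

Lemma poly_growth_node (n : nat) : poly_growth (node n).
Proof.
  unfold node; apply poly_growth_mult;
    [apply poly_growth_plus|]; auto using poly_growth_index, poly_growth_const.
Qed.

Lemma poly_growth_growth (g n : nat) : poly_growth (growth g n).
Proof.
  apply poly_growth_plus; [apply poly_growth_const|].
  apply poly_growth_pow, poly_growth_node.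
Qed.

Lemma poly_growth_spread (x : R) (g n : nat) : poly_growth (spread x g n).
Proof.
  apply poly_growth_mult; [apply poly_growth_plus | apply poly_growth_growth].
  - apply poly_growth_scal, poly_growth_pow, poly_growth_minus;
      auto using poly_growth_node, poly_growth_const.
  - apply poly_growth_const.
Qed.

Lemma node_moment_limit (a x : R) (m j : nat) : 0 <= a -> 0 <= x ->
  is_lim_seq (fun n => mean a x (n + j) (fun k => node n k ^ m)) (x ^ m).
Proof.
  intros ha hx; generalize (moment_limit a x m 2 j ha hx).
  apply is_lim_seq_ext; intro n; apply mean_ext; intro k.
  unfold node; simpl; do 2 f_equal; ring.
Qed.

Lemma growth_limit (a x : R) (g j : nat) : 0 <= a -> 0 <= x ->
  is_lim_seq (fun n => mean a x (n + j) (growth g n)) (1 + x ^ g).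
Proof.
  intros ha hx.
  apply (is_lim_seq_ext
    (fun n => 1 + mean a x (n + j) (fun k => node n k ^ g))).
  - intro n; unfold growth.
    rewrite (mean_plus a x (n + j) (fun _ => 1)), mean_const;
      auto using poly_growth_const, poly_growth_pow, poly_growth_node.
  - apply is_lim_seq_plus'; [apply is_lim_seq_const | now apply node_moment_limit].
Qed.

(** Expanded in powers of the node, the main part tends to
    [2 (x - x)^2 (1 + x^g) = 0]. *)
Lemma spread_limit (a x : R) (g j : nat) : 0 <= a -> 0 <= x ->
  is_lim_seq (fun n => mean a x (n + j) (spread x g n)) 0.
Proof.
  intros ha hx.
  set (M := fun m n => mean a x (n + j) (fun k => node n k ^ m)).
  apply (is_lim_seq_ext (fun n =>
    ((2 * M 2%nat n + 2 * M (g + 2)%nat n)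
     - (4 * x * M 1%nat n + 4 * x * M (g + 1)%nat n))
    + (2 * x ^ 2 + 8 * (/ (INR n + 1) * / (INR n + 1)))
      * mean a x (n + j) (growth g n))).
  - intro n; unfold M.
    assert (hp : forall c m, poly_growth (fun k => c * node n k ^ m)).
    { intros c m; apply poly_growth_scal, poly_growth_pow, poly_growth_node. }
    pose proof (poly_growth_growth g n).
    rewrite <- !mean_scal.
    rewrite <- !mean_plus by auto using poly_growth_plus.
    rewrite <- mean_minus by auto using poly_growth_plus.
    rewrite <- mean_plus
      by auto using poly_growth_plus, poly_growth_minus, poly_growth_scal.
    apply mean_ext; intro k; unfold spread, growth; rewrite !pow_add.
    pose proof (pos_INR n); field; lra.
  - replace (Finite 0) with
      (Finite (((2 * x ^ 2 + 2 * x ^ (g + 2))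
        - (4 * x * x ^ 1 + 4 * x * x ^ (g + 1)))
        + (2 * x ^ 2 + 8 * (0 * 0)) * (1 + x ^ g)))
      by (simpl; f_equal; rewrite !pow_add; ring).
    assert (lM : forall c m, is_lim_seq (fun n => c * M m n) (c * x ^ m)).
    { intros c m; apply is_lim_seq_mult'; [apply is_lim_seq_const|].
      now apply node_moment_limit. }
    apply is_lim_seq_plus'.
    + apply is_lim_seq_minus'; apply is_lim_seq_plus'; apply lM.
    + apply is_lim_seq_mult'; [|now apply growth_limit].
      apply is_lim_seq_plus'; [apply is_lim_seq_const|].
      apply is_lim_seq_mult'; [apply is_lim_seq_const|].
      apply is_lim_seq_mult'; apply lim_inv_succ.
Qed.

(** * Expectations in two variables *)

Definition poly_growth2 (T : nat -> nat -> R) : Prop :=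
  exists (M : R) (m l : nat), forall k1 k2,
    Rabs (T k1 k2) <= M * (INR k1 + 1) ^ m * (INR k2 + 1) ^ l.

Definition mean2 (a x y : R) (n1 n2 : nat) (T : nat -> nat -> R) : R :=
  mean a x n1 (fun k1 => mean a y n2 (T k1)).

Lemma poly_growth2_row (T : nat -> nat -> R) (k1 : nat) :
  poly_growth2 T -> poly_growth (T k1).
Proof.
  intros [M [m [l h]]]; exists (M * (INR k1 + 1) ^ m), l; intro k2; apply h.
Qed.

Lemma poly_growth2_swap (T : nat -> nat -> R) :
  poly_growth2 T -> poly_growth2 (fun k2 k1 => T k1 k2).
Proof.
  intros [M [m [l h]]]; exists M, l, m; intros k2 k1.
  specialize (h k1 k2); lra.
Qed.

Lemma poly_growth_index_pow (m : nat) : poly_growth (fun k => (INR k + 1) ^ m).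
Proof.
  apply poly_growth_pow, poly_growth_plus;
    auto using poly_growth_index, poly_growth_const.
Qed.

Lemma poly_growth2_mean (a y : R) (n : nat) (T : nat -> nat -> R) :
  0 <= a -> 0 <= y -> poly_growth2 T ->
  poly_growth (fun k1 => mean a y n (T k1)).
Proof.
  intros ha hy [M [m [l h]]].
  exists (M * mean a y n (fun k => (INR k + 1) ^ l)), m; intro k1.
  replace (M * mean a y n (fun k => (INR k + 1) ^ l) * (INR k1 + 1) ^ m)
    with (mean a y n (fun k => M * (INR k1 + 1) ^ m * (INR k + 1) ^ l))
    by (rewrite mean_scal; ring).
  apply mean_abs_le; auto using poly_growth_scal, poly_growth_index_pow.
Qed.

Lemma poly_growth2_diff (T : nat -> nat -> R) :
  poly_growth2 T -> poly_growth2 (fun k1 k2 => T (S k1) k2 - T k1 k2).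
Proof.
  intros [M [m [l h]]]; exists (M * 2 ^ m + M), m, l; intros k1 k2.
  pose proof (h k1 k2) as h1; pose proof (h (S k1) k2) as h2.
  assert (hM : 0 <= M).
  { specialize (h O O); simpl INR in h; rewrite Rplus_0_l, !pow1 in h.
    pose proof (Rabs_pos (T O O)); lra. }
  pose proof (pos_INR k1); pose proof (pos_INR k2).
  assert (h3 : (INR (S k1) + 1) ^ m <= 2 ^ m * (INR k1 + 1) ^ m).
  { rewrite <- Rpow_mult_distr, S_INR; apply pow_incr; lra. }
  assert (h4 : 0 <= (INR k2 + 1) ^ l) by (apply pow_le; lra).
  apply (Rmult_le_compat_l _ _ _ (Rmult_le_pos _ _ hM h4)) in h3.
  unfold Rminus; eapply Rle_trans; [apply Rabs_triang|]; rewrite Rabs_Ropp; lra.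
Qed.

Lemma mean2_close (a x y L e c : R) (n1 n2 : nat) (T : nat -> nat -> R)
    (q1 r1 q2 r2 : nat -> R) :
  0 <= a -> 0 <= x -> 0 <= y -> poly_growth2 T ->
  poly_growth q1 -> poly_growth r1 -> poly_growth q2 -> poly_growth r2 ->
  (forall k1 k2,
    Rabs (T k1 k2 - L) <= e + c * (q1 k1 * r2 k2 + r1 k1 * q2 k2)) ->
  Rabs (mean2 a x y n1 n2 T - L)
  <= e + c * (mean a x n1 q1 * mean a y n2 r2 + mean a x n1 r1 * mean a y n2 q2).
Proof.
  intros ha hx hy hT hq1 hr1 hq2 hr2 h; unfold mean2.
  rewrite <- (mean_const a x n1 L) by assumption.
  rewrite <- mean_minus; auto using poly_growth_const, poly_growth2_mean.
  replace (e + c * (mean a x n1 q1 * mean a y n2 r2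
                    + mean a x n1 r1 * mean a y n2 q2))
    with (mean a x n1 (fun k1 => e + (c * mean a y n2 r2 * q1 k1
                                      + c * mean a y n2 q2 * r1 k1))).
  2:{ rewrite (mean_plus a x n1 (fun _ => e)), mean_plus, !mean_scal, mean_const;
        auto using poly_growth_const, poly_growth_plus, poly_growth_scal.
      ring. }
  apply mean_abs_le;
    auto using poly_growth_const, poly_growth_plus, poly_growth_scal.
  intro k1.
  rewrite <- (mean_const a y n2 L) by assumption.
  rewrite <- mean_minus; eauto using poly_growth_const, poly_growth2_row.
  replace (e + (c * mean a y n2 r2 * q1 k1 + c * mean a y n2 q2 * r1 k1))
    with (mean a y n2 (fun k2 => e + (c * q1 k1 * r2 k2 + c * r1 k1 * q2 k2))).
  2:{ rewrite (mean_plus a y n2 (fun _ => e)), mean_plus, !mean_scal, mean_const;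
        auto using poly_growth_const, poly_growth_plus, poly_growth_scal.
      ring. }
  apply mean_abs_le;
    auto using poly_growth_const, poly_growth_plus, poly_growth_scal.
  intro k2; specialize (h k1 k2); lra.
Qed.

(** The first differences of [G n], scaled by [n + 1], are close to [L] where the
    cell is close to [(x, y)], and elsewhere are dominated by a function whose
    expectation tends to zero. *)
Definition difference_quotient_close (x y L : R) (g1 g2 : nat)
    (G : nat -> nat -> nat -> R) : Prop :=
  forall e, 0 < e -> exists c, forall n k1 k2,
    Rabs ((INR n + 1) * (G n (S k1) k2 - G n k1 k2) - L)
    <= e + c * (spread x g1 n k1 * growth g2 n k2
                + growth g1 n k1 * spread y g2 n k2).

Lemma mean2_difference_limit (a x y L : R) (g1 g2 j : nat)
    (G : nat -> nat -> nat -> R) :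
  0 <= a -> 0 <= x -> 0 <= y -> (forall n, poly_growth2 (G n)) ->
  difference_quotient_close x y L g1 g2 G ->
  is_lim_seq (fun n => mean2 a x y (n + j) n
    (fun k1 k2 => (INR n + 1) * (G n (S k1) k2 - G n k1 k2))) L.
Proof.
  intros ha hx hy hG hclose; apply is_lim_seq_spec; intros [eps heps]; simpl.
  destruct (hclose (eps / 2) ltac:(lra)) as [c hc].
  set (B := fun n => mean a x (n + j) (spread x g1 n) * mean a y n (growth g2 n)
    + mean a x (n + j) (growth g1 n) * mean a y n (spread y g2 n)).
  assert (hB : is_lim_seq (fun n => c * B n) 0).
  { replace (Finite 0) with
      (Finite (c * (0 * (1 + y ^ g2) + (1 + x ^ g1) * 0)))
      by (f_equal; ring).
    apply is_lim_seq_mult'; [apply is_lim_seq_const|].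
    assert (hr : is_lim_seq (fun n => mean a y n (growth g2 n)) (1 + y ^ g2)).
    { generalize (growth_limit a y g2 0 ha hy); apply is_lim_seq_ext.
      intro n; now rewrite Nat.add_0_r. }
    assert (hq : is_lim_seq (fun n => mean a y n (spread y g2 n)) 0).
    { generalize (spread_limit a y g2 0 ha hy); apply is_lim_seq_ext.
      intro n; now rewrite Nat.add_0_r. }
    pose proof (spread_limit a x g1 j ha hx).
    pose proof (growth_limit a x g1 j ha hx).
    now apply is_lim_seq_plus'; apply is_lim_seq_mult'. }
  apply is_lim_seq_spec in hB.
  destruct (hB (mkposreal (eps / 2) ltac:(lra))) as [N hN]; simpl in hN.
  exists N; intros n hn; specialize (hN n hn); apply Rabs_def2 in hN.
  eapply Rle_lt_trans.
  - apply mean2_close; try apply (hc n);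
      auto using poly_growth_spread, poly_growth_growth.
    destruct (poly_growth2_diff _ (hG n)) as [M [m [l h]]].
    exists ((INR n + 1) * M), m, l; intros k1 k2; pose proof (pos_INR n).
    rewrite Rabs_mult, (Rabs_pos_eq (INR n + 1)) by lra.
    specialize (h k1 k2); apply (Rmult_le_compat_l (INR n + 1)) in h; lra.
  - fold (B n); lra.
Qed.

(** By [mean_is_derive] the derivative is
    [a / ((1 + x)^2 (n + 1))] times one expectation of the scaled differences plus
    [n / (n + 1)] times another, and both expectations tend to [L]. *)
Lemma mean2_derivative_limit (a x y L : R) (g1 g2 : nat)
    (G : nat -> nat -> nat -> R) :
  0 <= a -> 0 < x -> 0 <= y -> (forall n, poly_growth2 (G n)) ->
  difference_quotient_close x y L g1 g2 G ->
  (forall n, ex_derive (fun w => mean2 a w y n n (G n)) x) /\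
  is_lim_seq (fun n => Derive (fun w => mean2 a w y n n (G n)) x) L.
Proof.
  intros ha hx hy hG hclose.
  set (T := fun n k1 k2 => (INR n + 1) * (G n (S k1) k2 - G n k1 k2)).
  assert (hd : forall n, is_derive (fun w => mean2 a w y n n (G n)) x
    (a / (1 + x) ^ 2 * / (INR n + 1) * mean2 a x y (n + 0) n (T n)
     + (1 + - 1 * / (INR n + 1)) * mean2 a x y (n + 1) n (T n))).
  { intro n; pose proof (pos_INR n).
    evar_last.
    { apply (mean_is_derive a x n (fun k1 => mean a y n (G n k1)) ha hx).
      now apply poly_growth2_mean. }
    assert (hT : forall p,
      mean a x p (fun k => mean a y n (G n (S k)) - mean a y n (G n k))
      = / (INR n + 1) * mean2 a x y p n (T n)).
    { intro p; unfold mean2; rewrite <- mean_scal; apply mean_ext; intro k1.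
      unfold T; rewrite mean_scal, mean_minus;
        eauto using poly_growth2_row; field; lra. }
    rewrite !hT, Nat.add_0_r, Nat.add_1_r; field; lra. }
  split.
  - intro n; eexists; apply hd.
  - apply (is_lim_seq_ext (fun n =>
      a / (1 + x) ^ 2 * / (INR n + 1) * mean2 a x y (n + 0) n (T n)
      + (1 + - 1 * / (INR n + 1)) * mean2 a x y (n + 1) n (T n))).
    { intro n; symmetry; apply is_derive_unique, hd. }
    replace (Finite L) with
      (Finite (a / (1 + x) ^ 2 * 0 * L + (1 + -1 * 0) * L)) by (f_equal; ring).
    assert (hl : forall j,
      is_lim_seq (fun n => mean2 a x y (n + j) n (T n)) L).
    { intro j; apply (mean2_difference_limit a x y L g1 g2); auto; lra. }
    apply is_lim_seq_plus'; apply is_lim_seq_mult'; try apply hl.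
    + apply is_lim_seq_mult'; [apply is_lim_seq_const | apply lim_inv_succ].
    + apply is_lim_seq_plus'; [apply is_lim_seq_const|].
      apply is_lim_seq_mult'; [apply is_lim_seq_const | apply lim_inv_succ].
Qed.

(** * Interchange of the two summations *)

Lemma Series_remainder (u : nat -> R) (N : nat) : ex_series u ->
  Series u - sum_n u N = Series (fun k => u (S N + k)%nat).
Proof.
  intro h; rewrite (Series_incr_n u (S N)) by (assumption || lia).
  rewrite sum_n_Reals; simpl pred; ring.
Qed.

Lemma sum_n_Series (u : nat -> nat -> R) (N : nat) :
  (forall j, ex_series (u j)) ->
  ex_series (fun k => sum_n (fun j => u j k) N) /\
  sum_n (fun j => Series (u j)) N = Series (fun k => sum_n (fun j => u j k) N).
Proof.
  intro h; induction N as [|N [IH1 IH2]].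
  - split.
    + apply (ex_series_ext (u O)); [intro k; now rewrite sum_O | apply h].
    + rewrite sum_O; apply Series_ext; intro k; now rewrite sum_O.
  - assert (e : forall k, sum_n (fun j => u j k) N + u (S N) k
                          = sum_n (fun j => u j k) (S N)).
    { intro k; now rewrite sum_Sn. }
    split.
    + apply (ex_series_ext _ _ e).
      now apply (ex_series_plus (V := R_NormedModule)).
    + rewrite sum_Sn, IH2; change plus with Rplus.
      rewrite <- Series_plus by auto; now apply Series_ext.
Qed.

(** Fubini for a double series dominated by a product: interchanging a series with
    a finite partial sum costs nothing, and the remaining columns are bounded by
    the tail of [b] times [c]. *)
Lemma Series_swap (u : nat -> nat -> R) (b c : nat -> R) :
  (forall j k, Rabs (u j k) <= b j * c k) -> ex_series b -> ex_series c ->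
  (forall k, 0 <= c k) ->
  Series (fun j => Series (u j)) = Series (fun k => Series (fun j => u j k)).
Proof.
  intros h hb hc c0.
  assert (hrow : forall j, ex_series (u j)).
  { intro j; apply (ex_series_dominated _ (fun k => b j * c k)); auto.
    now apply ex_series_mult_l. }
  assert (hcol : forall k, ex_series (fun j => u j k)).
  { intro k; apply (ex_series_dominated _ (fun j => c k * b j)).
    - intro j; rewrite Rmult_comm; apply h.
    - now apply ex_series_mult_l. }
  assert (hrem : forall N k,
    Rabs (Series (fun j => u j k) - sum_n (fun j => u j k) N)
    <= (Series b - sum_n b N) * c k).
  { intros N k; rewrite !Series_remainder by auto.
    rewrite <- Series_scal_r.
    assert (hs : ex_series (fun j => b (S N + j)%nat * c k)).
    { apply (ex_series_ext (fun j => c k * b (S N + j)%nat)).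
      { intro j; apply Rmult_comm. }
      now apply ex_series_mult_l, (ex_series_incr_n b (S N)). }
    eapply Rle_trans; [apply Series_Rabs | apply Series_le; auto].
    - apply (ex_series_dominated _ (fun j => b (S N + j)%nat * c k)); auto.
      intro j; rewrite Rabs_Rabsolu; apply h.
    - intro j; split; [apply Rabs_pos | apply h]. }
  assert (hcols : ex_series (fun k => Series (fun j => u j k))).
  { apply (ex_series_dominated _ (fun k => Series b * c k)).
    - intro k; rewrite <- Series_scal_r.
      assert (hs : ex_series (fun j => b j * c k)).
      { apply (ex_series_ext (fun j => c k * b j)); [intro j; apply Rmult_comm|].
        now apply ex_series_mult_l. }
      eapply Rle_trans; [apply Series_Rabs | apply Series_le; auto].
      + apply (ex_series_dominated _ (fun j => b j * c k)); auto.
        intro j; rewrite Rabs_Rabsolu; apply h.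
      + intro j; split; [apply Rabs_pos | apply h].
    - now apply ex_series_mult_l. }
  apply is_series_unique.
  assert (hlim : is_lim_seq (fun N => (Series b - sum_n b N) * Series c) 0).
  { replace (Finite 0) with (Finite ((Series b - Series b) * Series c))
      by (f_equal; ring).
    apply is_lim_seq_mult'; [|apply is_lim_seq_const].
    apply is_lim_seq_minus'; [apply is_lim_seq_const|].
    exact (Series_correct b hb). }
  change (is_lim_seq (sum_n (fun j => Series (u j)))
            (Series (fun k => Series (fun j => u j k)))).
  set (S0 := Series (fun k => Series (fun j => u j k))).
  apply (is_lim_seq_ext
    (fun N => S0 - (S0 - sum_n (fun j => Series (u j)) N))).
  { intro N; ring. }
  replace (Finite S0) with (Finite (S0 - 0)) by (f_equal; ring).
  apply is_lim_seq_minus'; [apply is_lim_seq_const|].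
  apply is_lim_seq_abs_0.
  apply (is_lim_seq_le_le (fun _ => 0) _ (fun N => (Series b - sum_n b N) * Series c));
    [|apply is_lim_seq_const | exact hlim].
  intro N; split; [apply Rabs_pos|].
  destruct (sum_n_Series u N hrow) as [h1 h2].
  rewrite h2; unfold S0; rewrite <- Series_minus by assumption.
  rewrite <- Series_scal_l.
  assert (hs : ex_series (fun k => (Series b - sum_n b N) * c k))
    by now apply ex_series_mult_l.
  eapply Rle_trans; [apply Series_Rabs | apply Series_le; auto].
  - apply (ex_series_dominated _ (fun k => (Series b - sum_n b N) * c k)); auto.
    intro k; rewrite Rabs_Rabsolu; apply hrem.
  - intro k; split; [apply Rabs_pos | apply hrem].
Qed.

Lemma mean2_swap (a x y : R) (n1 n2 : nat) (T : nat -> nat -> R) :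
  0 <= a -> 0 <= x -> 0 <= y -> poly_growth2 T ->
  mean2 a x y n1 n2 T = mean2 a y x n2 n1 (fun k2 k1 => T k1 k2).
Proof.
  intros ha hx hy [M [m [l h]]]; unfold mean2, mean.
  transitivity (Series (fun k1 => Series (fun k2 =>
    W a n1 k1 x * (W a n2 k2 y * T k1 k2)))).
  { apply Series_ext; intro k1; now rewrite Series_scal_l. }
  rewrite (Series_swap _ (fun k1 => W a n1 k1 x * (M * (INR k1 + 1) ^ m))
                         (fun k2 => W a n2 k2 y * (INR k2 + 1) ^ l)).
  - apply Series_ext; intro k2; rewrite <- Series_scal_l.
    apply Series_ext; intro k1; ring.
  - intros k1 k2; pose proof (W_nonneg a x n1 k1 ha hx) as w1.
    pose proof (W_nonneg a y n2 k2 ha hy) as w2.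
    rewrite !Rabs_mult, (Rabs_pos_eq _ w1), (Rabs_pos_eq _ w2).
    specialize (h k1 k2).
    apply (Rmult_le_compat_l _ _ _ (Rmult_le_pos _ _ w1 w2)) in h; lra.
  - apply mean_summable; auto using poly_growth_scal, poly_growth_index_pow.
  - apply mean_summable; auto using poly_growth_index_pow.
  - intro k2; apply Rmult_le_pos; [now apply W_nonneg|].
    apply pow_le; pose proof (pos_INR k2); lra.
Qed.

(** * Integrals over rectangles *)

Definition continuous2 (phi : R -> R -> R) : Prop :=
  forall u v, continuity_2d_pt phi u v.

Lemma continuous2_shift (phi : R -> R -> R) (h k : R) :
  continuous2 phi -> continuous2 (fun u v => phi (u + h) (v + k)).
Proof.
  intros hphi u v eps; destruct (hphi (u + h) (v + k) eps) as [d hd].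
  exists d; intros u' v' hu hv; apply hd.
  - now replace (u' + h - (u + h)) with (u' - u) by ring.
  - now replace (v' + k - (v + k)) with (v' - v) by ring.
Qed.

Lemma continuous2_fst (phi : R -> R -> R) (v u : R) :
  continuous2 phi -> continuity_pt (fun t => phi t v) u.
Proof.
  intro hphi; apply continuity_pt_filterlim, filterlim_locally; intro eps.
  destruct (hphi u v eps) as [d hd]; exists d; intros t ht.
  apply hd; [exact ht|].
  rewrite Rminus_diag, Rabs_R0; apply cond_pos.
Qed.

Lemma continuous2_snd (phi : R -> R -> R) (u v : R) :
  continuous2 phi -> continuity_pt (fun t => phi u t) v.
Proof.
  intro hphi; apply continuity_pt_filterlim, filterlim_locally; intro eps.
  destruct (hphi u v eps) as [d hd]; exists d; intros t ht.
  apply hd; [|exact ht].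
  rewrite Rminus_diag, Rabs_R0; apply cond_pos.
Qed.

Lemma ex_RInt_section (phi : R -> R -> R) (a b v : R) :
  continuous2 phi -> ex_RInt (fun u => phi u v) a b.
Proof.
  intro hphi; apply (ex_RInt_continuous (V := R_CompleteNormedModule)).
  intros u _; now apply continuity_pt_filterlim, continuous2_fst.
Qed.

(** Continuity of a parametric integral, from uniform continuity of the integrand
    near the segment from [(a, v)] to [(b, v)]. *)
Lemma RInt_section_continuous (phi : R -> R -> R) (a b v : R) :
  a <= b -> continuous2 phi ->
  continuity_pt (fun v => RInt (fun u => phi u v) a b) v.
Proof.
  intros hab hphi; apply continuity_pt_filterlim, filterlim_locally.
  intros [eps heps].
  assert (he : 0 < eps / (b - a + 1)) by (apply Rdiv_lt_0_compat; lra).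
  destruct (uniform_continuity_2d_1d phi a b v (fun u _ => hphi u v)
    (mkposreal _ he)) as [d hd]; simpl in hd.
  exists d; intros w hw; change (Rabs (w - v) < d) in hw.
  change (Rabs (RInt (fun u => phi u w) a b - RInt (fun u => phi u v) a b) < eps).
  pose proof (RInt_minus (V := R_CompleteNormedModule) _ _ a b
    (ex_RInt_section phi a b w hphi) (ex_RInt_section phi a b v hphi)) as e.
  change minus with Rminus in e; rewrite <- e.
  apply Rle_lt_trans with ((b - a) * (eps / (b - a + 1))).
  - apply abs_RInt_le_const; [exact hab| |].
    + apply (ex_RInt_minus (V := R_NormedModule)); now apply ex_RInt_section.
    + intros u hu; left; apply Rabs_def2 in hw; pose proof (cond_pos d).
      apply hd; try lra.
      rewrite Rminus_diag, Rabs_R0; lra.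
  - apply (Rmult_lt_reg_r (b - a + 1)); [lra|].
    field_simplify; [nra | lra].
Qed.

Definition RInt2 (phi : R -> R -> R) (a b c d : R) : R :=
  RInt (fun v => RInt (fun u => phi u v) a b) c d.

Lemma ex_RInt2 (phi : R -> R -> R) (a b c d : R) : a <= b -> continuous2 phi ->
  ex_RInt (fun v => RInt (fun u => phi u v) a b) c d.
Proof.
  intros hab hphi; apply (ex_RInt_continuous (V := R_CompleteNormedModule)).
  intros v _; now apply continuity_pt_filterlim, RInt_section_continuous.
Qed.

Lemma RInt2_bound (phi : R -> R -> R) (a b c d B : R) :
  a <= b -> c <= d -> continuous2 phi ->
  (forall u v, a <= u <= b -> c <= v <= d -> Rabs (phi u v) <= B) ->
  Rabs (RInt2 phi a b c d) <= (d - c) * ((b - a) * B).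
Proof.
  intros hab hcd hphi hB; apply abs_RInt_le_const; auto using ex_RInt2.
  intros v hv; apply abs_RInt_le_const; auto using ex_RInt_section.
Qed.

Lemma RInt2_minus (phi psi : R -> R -> R) (a b c d : R) :
  a <= b -> continuous2 phi -> continuous2 psi ->
  RInt2 (fun u v => phi u v - psi u v) a b c d
  = RInt2 phi a b c d - RInt2 psi a b c d.
Proof.
  intros hab h1 h2; unfold RInt2.
  rewrite <- (RInt_minus (V := R_CompleteNormedModule)
    (fun v => RInt (fun u => phi u v) a b)) by now apply ex_RInt2.
  apply RInt_ext; intros v _.
  now apply (RInt_minus (V := R_CompleteNormedModule)
    (fun u => phi u v)); apply ex_RInt_section.
Qed.

Lemma RInt2_scal (phi : R -> R -> R) (a b c d k : R) :
  a <= b -> continuous2 phi ->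
  RInt2 (fun u v => k * phi u v) a b c d = k * RInt2 phi a b c d.
Proof.
  intros hab h1; unfold RInt2.
  rewrite <- (RInt_scal (V := R_CompleteNormedModule)
    (fun v => RInt (fun u => phi u v) a b)) by now apply ex_RInt2.
  apply RInt_ext; intros v _.
  now apply (RInt_scal (V := R_CompleteNormedModule)
    (fun u => phi u v)), ex_RInt_section.
Qed.

Lemma RInt2_const (a b c d k : R) :
  RInt2 (fun _ _ => k) a b c d = (d - c) * ((b - a) * k).
Proof.
  unfold RInt2; rewrite (RInt_ext _ (fun _ => (b - a) * k)).
  - apply (RInt_const (V := R_CompleteNormedModule)).
  - intros v _; apply (RInt_const (V := R_CompleteNormedModule)).
Qed.

Lemma RInt_shift (F : R -> R) (a b h : R) : (forall t, continuity_pt F t) ->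
  RInt F (a + h) (b + h) = RInt (fun t => F (t + h)) a b.
Proof.
  intro hF.
  pose proof (RInt_comp_lin (V := R_CompleteNormedModule) F 1 h a b) as e.
  rewrite !Rmult_1_l in e; rewrite <- e.
  - apply RInt_ext; intros t _; unfold scal; simpl; unfold mult; simpl.
    now rewrite !Rmult_1_l.
  - apply (ex_RInt_continuous (V := R_CompleteNormedModule)).
    intros t _; now apply continuity_pt_filterlim.
Qed.

Lemma RInt2_shift (phi : R -> R -> R) (a b c d h k : R) :
  a <= b -> continuous2 phi ->
  RInt2 phi (a + h) (b + h) (c + k) (d + k)
  = RInt2 (fun u v => phi (u + h) (v + k)) a b c d.
Proof.
  intros hab hphi; unfold RInt2; rewrite RInt_shift.
  - apply RInt_ext; intros v _; apply RInt_shift.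
    intro t; now apply continuous2_fst.
  - intro v; apply RInt_section_continuous; auto; lra.
Qed.

(** * Averages over the cells of the grid *)

Definition cell_average (phi : R -> R -> R) (n k1 k2 : nat) : R :=
  (INR n + 1) * (INR n + 1) *
  RInt2 phi (INR k1 / (INR n + 1)) ((INR k1 + 1) / (INR n + 1))
            (INR k2 / (INR n + 1)) ((INR k2 + 1) / (INR n + 1)).

Lemma cell_ordered (n k : nat) :
  INR k / (INR n + 1) <= (INR k + 1) / (INR n + 1).
Proof.
  pose proof (pos_INR n); apply Rmult_le_compat_r; [|lra].
  left; apply Rinv_0_lt_compat; lra.
Qed.

Lemma cell_left_nonneg (n k : nat) : 0 <= INR k / (INR n + 1).
Proof.
  pose proof (pos_INR n); pose proof (pos_INR k); apply Rdiv_le_0_compat; lra.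
Qed.

Lemma cell_right_next (n k : nat) :
  (INR k + 1) / (INR n + 1) + / (INR n + 1) = node n k.
Proof. pose proof (pos_INR n); unfold node; field; lra. Qed.

Lemma cell_average_bound (phi : R -> R -> R) (n k1 k2 : nat) (B : R) :
  continuous2 phi ->
  (forall u v, INR k1 / (INR n + 1) <= u <= (INR k1 + 1) / (INR n + 1) ->
    INR k2 / (INR n + 1) <= v <= (INR k2 + 1) / (INR n + 1) ->
    Rabs (phi u v) <= B) ->
  Rabs (cell_average phi n k1 k2) <= B.
Proof.
  intros hphi hB; pose proof (pos_INR n); unfold cell_average.
  pose proof (RInt2_bound phi _ _ _ _ B (cell_ordered n k1) (cell_ordered n k2)
    hphi hB) as h.
  rewrite Rabs_mult, Rabs_pos_eq by nra.
  apply (Rmult_le_compat_l ((INR n + 1) * (INR n + 1))) in h; [|nra].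
  eapply Rle_trans; [exact h|]; right; field; lra.
Qed.

Lemma cell_average_affine (phi psi : R -> R -> R) (n k1 k2 : nat) (s L : R) :
  continuous2 phi -> continuous2 psi ->
  s * (cell_average phi n k1 k2 - cell_average psi n k1 k2) - L
  = cell_average (fun u v => s * (phi u v - psi u v) - L) n k1 k2.
Proof.
  intros h1 h2; pose proof (pos_INR n); unfold cell_average.
  assert (h3 : continuous2 (fun u v => phi u v - psi u v)).
  { intros u v; now apply continuity_2d_pt_minus. }
  rewrite (RInt2_minus (fun u v => s * (phi u v - psi u v)) (fun _ _ => L)).
  - rewrite RInt2_scal, RInt2_minus, RInt2_const; auto using cell_ordered.
    field; lra.
  - apply cell_ordered.
  - intros u v; apply continuity_2d_pt_mult; [apply continuity_2d_pt_const | apply h3].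
  - intros u v; apply continuity_2d_pt_const.
Qed.

Lemma cell_average_difference_bound (phi psi : R -> R -> R)
    (n k1 k2 : nat) (s L B : R) :
  continuous2 phi -> continuous2 psi ->
  (forall u v, INR k1 / (INR n + 1) <= u <= (INR k1 + 1) / (INR n + 1) ->
    INR k2 / (INR n + 1) <= v <= (INR k2 + 1) / (INR n + 1) ->
    Rabs (s * (phi u v - psi u v) - L) <= B) ->
  Rabs (s * (cell_average phi n k1 k2 - cell_average psi n k1 k2) - L) <= B.
Proof.
  intros h1 h2 hB; rewrite cell_average_affine by assumption.
  apply cell_average_bound; [|exact hB].
  intros u v; apply continuity_2d_pt_minus; [|apply continuity_2d_pt_const].
  apply continuity_2d_pt_mult; [apply continuity_2d_pt_const|].
  now apply continuity_2d_pt_minus.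
Qed.

Lemma cell_average_ext (phi psi : R -> R -> R) (n k1 k2 : nat) :
  (forall u v, 0 < u -> 0 < v -> phi u v = psi u v) ->
  cell_average phi n k1 k2 = cell_average psi n k1 k2.
Proof.
  intro h; unfold cell_average, RInt2; f_equal.
  apply RInt_ext; intros v hv; apply RInt_ext; intros u hu.
  rewrite Rmin_left in hu, hv by apply cell_ordered.
  pose proof (cell_left_nonneg n k1); pose proof (cell_left_nonneg n k2).
  apply h; lra.
Qed.

Lemma cell_average_shift_x (phi : R -> R -> R) (n k1 k2 : nat) :
  continuous2 phi ->
  cell_average phi n (S k1) k2
  = cell_average (fun u v => phi (u + / (INR n + 1)) v) n k1 k2.
Proof.
  intro hphi; pose proof (pos_INR n); unfold cell_average; f_equal.
  replace (INR (S k1) / (INR n + 1)) with (INR k1 / (INR n + 1) + / (INR n + 1))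
    by (rewrite S_INR; field; lra).
  replace ((INR (S k1) + 1) / (INR n + 1))
    with ((INR k1 + 1) / (INR n + 1) + / (INR n + 1))
    by (rewrite S_INR; field; lra).
  pose proof (RInt2_shift phi _ _ (INR k2 / (INR n + 1))
    ((INR k2 + 1) / (INR n + 1)) (/ (INR n + 1)) 0 (cell_ordered n k1) hphi) as e.
  rewrite !Rplus_0_r in e; rewrite e.
  apply RInt_ext; intros v _; now rewrite Rplus_0_r.
Qed.

Lemma cell_average_shift_y (phi : R -> R -> R) (n k1 k2 : nat) :
  continuous2 phi ->
  cell_average phi n k1 (S k2)
  = cell_average (fun u v => phi u (v + / (INR n + 1))) n k1 k2.
Proof.
  intro hphi; pose proof (pos_INR n); unfold cell_average; f_equal.
  replace (INR (S k2) / (INR n + 1)) with (INR k2 / (INR n + 1) + / (INR n + 1))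
    by (rewrite S_INR; field; lra).
  replace ((INR (S k2) + 1) / (INR n + 1))
    with ((INR k2 + 1) / (INR n + 1) + / (INR n + 1))
    by (rewrite S_INR; field; lra).
  pose proof (RInt2_shift phi _ _ (INR k2 / (INR n + 1))
    ((INR k2 + 1) / (INR n + 1)) 0 (/ (INR n + 1)) (cell_ordered n k1) hphi) as e.
  rewrite !Rplus_0_r in e; rewrite e.
  apply RInt_ext; intros v _; apply RInt_ext; intros u _; now rewrite Rplus_0_r.
Qed.

(** * Weighted functions on the quadrant *)

Lemma quadrant_continuity (f : R -> R -> R) (x y eps : R) :
  continuous_on quadrant (fun p : R * R => f (fst p) (snd p)) ->
  0 <= x -> 0 <= y -> 0 < eps ->
  exists d, 0 < d /\ forall u v, 0 <= u -> 0 <= v ->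
    Rabs (u - x) < d -> Rabs (v - y) < d -> Rabs (f u v - f x y) < eps.
Proof.
  intros hc hx hy heps.
  destruct (proj1 (filterlim_locally _ _) (hc (x, y) (conj hx hy))
    (mkposreal eps heps)) as [d hd].
  exists d; split; [apply cond_pos|]; intros u v hu hv hux hvy.
  exact (hd (u, v) (conj hux hvy) (conj hu hv)).
Qed.

(** A function given on the closed quadrant need not be continuous on [R * R] at
    the boundary points. Composing with the projection onto the quadrant repairs
    this without changing any integral over the cells. *)
Definition extend (f : R -> R -> R) (u v : R) : R := f (Rmax 0 u) (Rmax 0 v).

Lemma extend_eq (f : R -> R -> R) (u v : R) : 0 <= u -> 0 <= v ->
  extend f u v = f u v.
Proof. intros hu hv; unfold extend; now rewrite !Rmax_right. Qed.

Lemma Rmax_0_lipschitz (s t : R) : Rabs (Rmax 0 s - Rmax 0 t) <= Rabs (s - t).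
Proof. unfold Rmax, Rabs; repeat destruct Rle_dec; repeat destruct Rcase_abs; lra. Qed.

Lemma extend_continuous (f : R -> R -> R) :
  continuous_on quadrant (fun p : R * R => f (fst p) (snd p)) ->
  continuous2 (extend f).
Proof.
  intros hc x y [eps heps].
  destruct (quadrant_continuity f (Rmax 0 x) (Rmax 0 y) eps hc
    (Rmax_l _ _) (Rmax_l _ _) heps) as [d [hd h]].
  exists (mkposreal d hd); intros u v hu hv; apply h; try apply Rmax_l;
    eapply Rle_lt_trans; [apply Rmax_0_lipschitz | exact hu
                         |apply Rmax_0_lipschitz | exact hv].
Qed.

Lemma weighted_bound (g1 g2 : nat) (f : R -> R -> R) : C_weighted g1 g2 f ->
  exists M, 0 <= M /\ forall u v, 0 <= u -> 0 <= v ->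
    Rabs (f u v) <= M * ((1 + u ^ g1) * (1 + v ^ g2)).
Proof.
  intros [_ [[M h] _]]; exists M; split.
  { pose proof (h 0 0 (Rle_refl 0) (Rle_refl 0)).
    pose proof (Rabs_pos (weight2 g1 g2 0 0 * f 0 0)); lra. }
  intros u v hu hv; specialize (h u v hu hv).
  pose proof (pow_le u g1 hu); pose proof (pow_le v g2 hv).
  unfold weight2, weight in h.
  replace (f u v) with ((1 + u ^ g1) * (1 + v ^ g2)
    * (/ (1 + u ^ g1) * / (1 + v ^ g2) * f u v)) by (field; lra).
  assert (hp : 0 <= (1 + u ^ g1) * (1 + v ^ g2)) by (apply Rmult_le_pos; lra).
  rewrite Rabs_mult, (Rabs_pos_eq _ hp), (Rmult_comm M).
  now apply Rmult_le_compat_l.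
Qed.

Lemma cell_average_growth (g1 g2 n : nat) (f : R -> R -> R) :
  C_weighted g1 g2 f -> poly_growth2 (cell_average (extend f) n).
Proof.
  intro hf; destruct (weighted_bound g1 g2 f hf) as [M [hM h]].
  (* On cell [k] one has [1 + u^g <= 2 (k + 1)^g], once for each variable. *)
  exists (4 * M), g1, g2; intros k1 k2.
  apply cell_average_bound; [apply extend_continuous, hf|].
  assert (hcell : forall (k g : nat) u,
    INR k / (INR n + 1) <= u <= (INR k + 1) / (INR n + 1) ->
    0 <= u /\ 1 <= 1 + u ^ g <= 2 * (INR k + 1) ^ g).
  { intros k g u [l r]; pose proof (pos_INR n); pose proof (pos_INR k).
    assert (0 <= INR k / (INR n + 1)) by (apply Rdiv_le_0_compat; lra).
    assert ((INR k + 1) / (INR n + 1) <= INR k + 1).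
    { apply Rle_div_l; [lra|]; nra. }
    assert (hu : 0 <= u) by lra; split; [exact hu|].
    pose proof (pow_le u g hu).
    pose proof (pow_incr u (INR k + 1) g ltac:(lra)).
    pose proof (pow_R1_Rle (INR k + 1) g ltac:(lra)); lra. }
  intros u v hu hv.
  destruct (hcell k1 g1 u hu) as [u0 [ul ur]].
  destruct (hcell k2 g2 v hv) as [v0 [vl vr]].
  rewrite extend_eq by assumption; eapply Rle_trans; [now apply h|].
  replace (4 * M * (INR k1 + 1) ^ g1 * (INR k2 + 1) ^ g2)
    with (M * ((2 * (INR k1 + 1) ^ g1) * (2 * (INR k2 + 1) ^ g2))) by ring.
  apply Rmult_le_compat_l; [exact hM|]; apply Rmult_le_compat; lra.
Qed.

Lemma near_node (x xi : R) (g n k : nat) :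
  INR k / (INR n + 1) <= xi <= node n k ->
  0 <= xi /\ 1 <= 1 + xi ^ g <= growth g n k /\
  (xi - x) ^ 2 * growth g n k <= spread x g n k.
Proof.
  intros [l r]; pose proof (pos_INR n); pose proof (pos_INR k).
  assert (0 <= INR k / (INR n + 1)) by (apply Rdiv_le_0_compat; lra).
  assert (hxi : 0 <= xi) by lra.
  pose proof (pow_le xi g hxi); pose proof (pow_incr xi _ g (conj hxi r)).
  pose proof (growth_ge_1 g n k).
  repeat split; try lra; [unfold growth; lra|].
  unfold spread; apply Rmult_le_compat_r; [lra|].
  assert (e : INR k / (INR n + 1) = node n k - 2 * / (INR n + 1))
    by (unfold node; field; lra).
  assert (0 < / (INR n + 1)) by (apply Rinv_0_lt_compat; lra).
  rewrite <- pow_inv; set (d := / (INR n + 1)) in *; set (b := node n k) in *.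
  assert ((xi - b) ^ 2 <= 4 * d ^ 2) by nra.
  pose proof (pow2_ge_0 ((xi - b) - (b - x))); lra.
Qed.

(** The Korovkin-type estimate: within distance [d] of [(x, y)] continuity gives
    [e]; outside, the factor [((xi - x)^2 + (eta - y)^2) / d^2] is at least [1] and
    may multiply the growth bound. *)
Lemma weighted_close (g1 g2 : nat) (f : R -> R -> R) (x y e : R) :
  C_weighted g1 g2 f -> 0 <= x -> 0 <= y -> 0 < e ->
  exists c, forall n k1 k2 xi eta,
    INR k1 / (INR n + 1) <= xi <= node n k1 ->
    INR k2 / (INR n + 1) <= eta <= node n k2 ->
    Rabs (f xi eta - f x y)
    <= e + c * (spread x g1 n k1 * growth g2 n k2
                + growth g1 n k1 * spread y g2 n k2).
Proof.
  intros hf hx hy he; destruct (weighted_bound g1 g2 f hf) as [M [hM hb]].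
  destruct (quadrant_continuity f x y e (proj1 hf) hx hy he) as [d [hd hc]].
  set (A := M + Rabs (f x y)).
  assert (hA : 0 <= A) by (pose proof (Rabs_pos (f x y)); unfold A; lra).
  (* [A] times the product of the growth factors bounds the increment of [f]
     everywhere. *)
  exists (A / d ^ 2); intros n k1 k2 xi eta hxi heta.
  destruct (near_node x xi g1 n k1 hxi) as [xi0 [[xl xr] xs]].
  destruct (near_node y eta g2 n k2 heta) as [eta0 [[yl yr] ys]].
  pose proof (growth_ge_1 g1 n k1) as r1; pose proof (growth_ge_1 g2 n k2) as r2.
  set (Q := spread x g1 n k1 * growth g2 n k2
            + growth g1 n k1 * spread y g2 n k2).
  assert (hd2 : 0 < d ^ 2) by now apply pow_lt.
  assert (hQ : ((xi - x) ^ 2 + (eta - y) ^ 2)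
               * (growth g1 n k1 * growth g2 n k2) <= Q).
  { unfold Q; set (p := growth g1 n k1) in *; set (q := growth g2 n k2) in *.
    apply (Rmult_le_compat_r q) in xs; [|lra].
    apply (Rmult_le_compat_l p) in ys; [|lra]; lra. }
  assert (hp : 1 <= growth g1 n k1 * growth g2 n k2) by nra.
  set (p := growth g1 n k1 * growth g2 n k2) in *.
  pose proof (pow2_ge_0 (xi - x)); pose proof (pow2_ge_0 (eta - y)).
  assert (hAd : 0 <= A / d ^ 2) by (apply Rdiv_le_0_compat; lra).
  assert (hcase : (Rabs (xi - x) < d /\ Rabs (eta - y) < d)
                  \/ d ^ 2 <= (xi - x) ^ 2 + (eta - y) ^ 2).
  { assert (sq : forall t, d <= Rabs t -> d ^ 2 <= t ^ 2).
    { intros t ht; rewrite <- (pow2_abs t); apply pow_incr; lra. }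
    destruct (Rlt_le_dec (Rabs (xi - x)) d) as [l1|l1].
    - destruct (Rlt_le_dec (Rabs (eta - y)) d) as [l2|l2]; [now left|].
      right; specialize (sq _ l2); lra.
    - right; specialize (sq _ l1); lra. }
  destruct hcase as [[h1 h2]|hfar].
  - specialize (hc xi eta xi0 eta0 h1 h2).
    assert (0 <= A / d ^ 2 * Q) by (apply Rmult_le_pos; nra); lra.
  - assert (h1 : Rabs (f xi eta - f x y) <= A * p).
    { unfold Rminus; eapply Rle_trans; [apply Rabs_triang|]; rewrite Rabs_Ropp.
      specialize (hb xi eta xi0 eta0).
      assert ((1 + xi ^ g1) * (1 + eta ^ g2) <= p)
        by (apply Rmult_le_compat; lra).
      pose proof (Rabs_pos (f x y)); unfold A; nra. }
    assert (h2 : d ^ 2 * p <= Q).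
    { eapply Rle_trans; [|exact hQ]; apply Rmult_le_compat_r; lra. }
    assert (h3 : A * p <= A / d ^ 2 * Q).
    { apply (Rmult_le_compat_l (A / d ^ 2)) in h2; [|exact hAd].
      eapply Rle_trans; [|exact h2]; right; field; lra. }
    lra.
Qed.

(** * Partial derivatives and differences of cell averages *)

Lemma quotient_is_derive (F : R -> R) (x l : R) : 0 < x ->
  filterlim (fun t => (F t - F x) / (t - x))
    (within (fun t => 0 <= t) (locally' x)) (locally l) ->
  is_derive F x l.
Proof.
  intros hx hlim; apply is_derive_Reals; intros eps heps.
  destruct (proj1 (filterlim_locally _ _) hlim (mkposreal eps heps)) as [d hd].
  assert (hm : 0 < Rmin d x) by (apply Rmin_pos; [apply cond_pos | exact hx]).
  exists (mkposreal _ hm); intros h h0 hh; simpl in hh.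
  pose proof (Rmin_l d x); pose proof (Rmin_r d x).
  assert (hb : ball x d (x + h)).
  { change (Rabs (x + h - x) < d); replace (x + h - x) with h by ring; lra. }
  assert (hne : x + h <> x) by lra.
  assert (hp : 0 <= x + h) by (apply Rabs_def2 in hh; lra).
  specialize (hd (x + h) hb hne hp).
  change (Rabs ((F (x + h) - F x) / (x + h - x) - l) < eps) in hd.
  now replace (x + h - x) with h in hd by ring.
Qed.

Lemma is_derive_from_halfline (F G : R -> R) (x l : R) : 0 < x ->
  (forall t, 0 <= t -> F t = G t) -> is_derive F x l -> is_derive G x l.
Proof.
  intros hx h; apply is_derive_ext_loc.
  exists (mkposreal x hx); intros t ht; apply h.
  change (Rabs (t - x) < x) in ht; apply Rabs_def2 in ht; lra.
Qed.

Lemma extend_derive_x (f g : R -> R -> R) (u v : R) :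
  is_partial_x f g -> 0 < u -> 0 <= v ->
  is_derive (fun t => extend f t v) u (g u v).
Proof.
  intros h hu hv; apply (is_derive_from_halfline (fun t => f t v)); auto.
  - intros t ht; now rewrite extend_eq.
  - apply quotient_is_derive; auto; apply h; lra.
Qed.

Lemma extend_derive_y (f g : R -> R -> R) (u v : R) :
  is_partial_y f g -> 0 <= u -> 0 < v ->
  is_derive (fun t => extend f u t) v (g u v).
Proof.
  intros h hu hv; apply (is_derive_from_halfline (fun t => f u t)); auto.
  - intros t ht; now rewrite extend_eq.
  - apply quotient_is_derive; auto; apply h; lra.
Qed.

Lemma mean_value_halfline (F F' : R -> R) (u h : R) : 0 <= u -> 0 < h ->
  (forall t, continuity_pt F t) -> (forall t, 0 < t -> is_derive F t (F' t)) ->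
  exists xi, u <= xi <= u + h /\ F (u + h) - F u = F' xi * h.
Proof.
  intros hu hh hc hd.
  destruct (MVT_gen F u (u + h) F') as [xi [hxi e]].
  - intros t [ht _]; rewrite Rmin_left in ht by lra; apply hd; lra.
  - intros t _; apply hc.
  - rewrite Rmin_left, Rmax_right in hxi by lra.
    exists xi; split; [exact hxi|]; rewrite e; ring.
Qed.

(** The difference of the averages over adjacent cells is the average of
    [f (u + h) v - f u v] with [h = / (n + 1)], which the mean value theorem turns
    into [h] times a value of the partial derivative within the two cells. *)
Lemma difference_close_x (g1 g2 : nat) (f g : R -> R -> R) (x y : R) :
  C_weighted g1 g2 f -> C_weighted g1 g2 g -> is_partial_x f g ->
  0 <= x -> 0 <= y ->
  difference_quotient_close x y (g x y) g1 g2 (cell_average (extend f)).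
Proof.
  intros hf hg hp hx hy e he.
  destruct (weighted_close g1 g2 g x y e hg hx hy he) as [c hc].
  exists c; intros n k1 k2; pose proof (pos_INR n).
  pose proof (extend_continuous f (proj1 hf)) as hcont.
  assert (hshift : continuous2 (fun u v => extend f (u + / (INR n + 1)) v)).
  { intros u v.
    apply (continuity_2d_pt_ext
      (fun u v => extend f (u + / (INR n + 1)) (v + 0))).
    - intros; now rewrite Rplus_0_r.
    - now apply continuous2_shift. }
  rewrite cell_average_shift_x by assumption.
  apply cell_average_difference_bound; try assumption.
  intros u v hu hv.
  assert (hh : 0 < / (INR n + 1)) by (apply Rinv_0_lt_compat; lra).
  pose proof (cell_left_nonneg n k1); pose proof (cell_left_nonneg n k2).
  destruct (mean_value_halfline (fun t => extend f t v) (fun t => g t v) u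
    (/ (INR n + 1))) as [xi [hxi exi]]; try lra.
  { intro t; now apply continuous2_fst. }
  { intros t ht; apply extend_derive_x; auto; lra. }
  rewrite exi.
  replace ((INR n + 1) * (g xi v * / (INR n + 1))) with (g xi v) by (field; lra).
  apply hc; rewrite <- cell_right_next; lra.
Qed.

(** The same with the roles of the variables exchanged. The inner integral stays
    the one over [u], so no interchange of integrals occurs. *)
Lemma difference_close_y (g1 g2 : nat) (f g : R -> R -> R) (x y : R) :
  C_weighted g1 g2 f -> C_weighted g1 g2 g -> is_partial_y f g ->
  0 <= x -> 0 <= y ->
  difference_quotient_close y x (g x y) g2 g1
    (fun n k2 k1 => cell_average (extend f) n k1 k2).
Proof.
  intros hf hg hp hx hy e he.
  destruct (weighted_close g1 g2 g x y e hg hx hy he) as [c hc].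
  exists c; intros n k2 k1; pose proof (pos_INR n).
  pose proof (extend_continuous f (proj1 hf)) as hcont.
  assert (hshift : continuous2 (fun u v => extend f u (v + / (INR n + 1)))).
  { intros u v.
    apply (continuity_2d_pt_ext
      (fun u v => extend f (u + 0) (v + / (INR n + 1)))).
    - intros; now rewrite Rplus_0_r.
    - now apply continuous2_shift. }
  rewrite cell_average_shift_y by assumption.
  apply cell_average_difference_bound; try assumption.
  intros u v hu hv.
  assert (hh : 0 < / (INR n + 1)) by (apply Rinv_0_lt_compat; lra).
  pose proof (cell_left_nonneg n k1); pose proof (cell_left_nonneg n k2).
  destruct (mean_value_halfline (fun t => extend f u t) (fun t => g u t) v
    (/ (INR n + 1))) as [xi [hxi exi]]; try lra.
  { intro t; now apply continuous2_snd. }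
  { intros t ht; apply extend_derive_y; auto; lra. }
  rewrite exi.
  replace ((INR n + 1) * (g u xi * / (INR n + 1))) with (g u xi) by (field; lra).
  rewrite (Rplus_comm (spread y g2 n k2 * growth g1 n k1)),
    (Rmult_comm (spread y g2 n k2)), (Rmult_comm (growth g2 n k2)).
  apply hc; rewrite <- cell_right_next; lra.
Qed.

Lemma K_mean2 (a x y : R) (n : nat) (f : R -> R -> R) :
  K a n n f x y = mean2 a x y n n (cell_average (extend f) n).
Proof.
  unfold K, mean2, mean; rewrite <- Series_scal_l; apply Series_ext; intro k1.
  rewrite <- !Series_scal_l; apply Series_ext; intro k2.
  rewrite <- (cell_average_ext f (extend f)).
  - unfold cell_average, RInt2, W2; ring.
  - intros u v hu hv; rewrite extend_eq; lra.
Qed.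

(** * Convergence of the partial derivatives *)

Theorem theorem6 (a : R) (g1 g2 : nat) (f : R -> R -> R)
  (ha : 0 <= a) (hf : Cm_weighted 1 g1 g2 f)
  (x y : R) (hx : 0 < x) (hy : 0 < y) :
  ((forall n : nat, (1 <= n)%nat -> ex_derive (fun w => K a n n f w y) x) /\
   is_lim_seq (fun n => Derive (fun w => K a n n f w y) x)
              (Finite (Derive (fun w => f w y) x)))
  /\
  ((forall n : nat, (1 <= n)%nat -> ex_derive (fun v => K a n n f x v) y) /\
   is_lim_seq (fun n => Derive (fun v => K a n n f x v) y)
              (Finite (Derive (fun v => f x v) y))).
Proof.
  destruct hf as [hf [D [hD0 [hDy [hDx hD]]]]].
  specialize (hDy O (Nat.lt_0_1)); specialize (hDx O O Nat.lt_0_1).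
  pose proof (hD 1%nat O ltac:(lia)) as hgx.
  pose proof (hD O 1%nat ltac:(lia)) as hgy.
  rewrite hD0 in hDx, hDy.
  assert (hx0 : 0 <= x) by lra; assert (hy0 : 0 <= y) by lra.
  assert (hG : forall n, poly_growth2 (cell_average (extend f) n))
    by (intro n; now apply (cell_average_growth g1 g2)).
  split.
  - replace (Derive (fun w => f w y) x) with (D 1%nat O x y)
      by (symmetry; apply is_derive_unique, quotient_is_derive; auto).
    destruct (mean2_derivative_limit a x y (D 1%nat O x y) g1 g2
      (cell_average (extend f)) ha hx hy0 hG) as [h1 h2].
    { now apply difference_close_x. }
    split.
    + intros n _; apply (ex_derive_ext _ _ x (fun w => eq_sym (K_mean2 a w y n f))).
      apply h1.
    + revert h2; apply is_lim_seq_ext; intro n.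
      apply Derive_ext; intro w; symmetry; apply K_mean2.
  - replace (Derive (fun v => f x v) y) with (D O 1%nat x y)
      by (symmetry; apply is_derive_unique, quotient_is_derive; auto).
    destruct (mean2_derivative_limit a y x (D O 1%nat x y) g2 g1
      (fun n k2 k1 => cell_average (extend f) n k1 k2) ha hy hx0) as [h1 h2].
    { intro n; now apply poly_growth2_swap. }
    { now apply difference_close_y. }
    (* Interchanging the sums makes [y] the outer variable; the weights
       are nonnegative only for [v >= 0], which holds near the point. *)
    assert (hK : forall n, locally y (fun v =>
      mean2 a v x n n (fun k2 k1 => cell_average (extend f) n k1 k2)
      = K a n n f x v)).
    { intro n; exists (mkposreal y hy); intros v hv.
      change (Rabs (v - y) < y) in hv; apply Rabs_def2 in hv.
      rewrite K_mean2; symmetry; apply mean2_swap; auto; lra. }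
    split.
    + intros n _; apply (ex_derive_ext_loc _ _ y (hK n)), h1.
    + revert h2; apply is_lim_seq_ext; intro n.
      now apply Derive_ext_loc.
Qed.
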